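(* Let $\epsilon\in(0,1/d)$, $\rho_0\in\mathcal P_\epsilon$, and let Assumptions (A) and (B) of the context hold for $(\boldsymbol H,\boldsymbol B,g)$. For $N\in\mathbb N_+$ put $\tau=T/N$, $t_n=n\tau$, and consider the scheme for unknowns $(\phi^n,\rho^n)_{n=0}^N$: $$\rho^0=\rho_0,\qquad \phi^N=g(\rho^N),$$ $$\frac{\phi^{n+1}-\phi^n}{\tau}=\boldsymbol H(\rho^{n+1},\nabla_G\phi^n)-\Delta_G\phi^n,\qquad \frac{\rho^{n+1}-\rho^n}{\tau}=\operatorname{div}_G\boldsymbol B(\rho^{n+1},\nabla_G\phi^n)+\Delta_G\rho^{n+1},\qquad 0\le n\le N-1.$$ Call a solution interior if $\rho^n\in\mathcal P^\circ(G)$ for all $0\le n\le N$. Then the scheme has at most one interior solution. Moreover, every interior solution satisfies the following, where all constants may depend on $G$, the problem data, $\epsilon$ and $T$, but are independent of $N$ and $\tau$. (1) There exist $\delta_T,C_T>0$, independent of $N$ and $\tau$, such that $$\min_{0\le n\le N}\min_i\rho_i^n\ge\delta_T,\qquad \max_{0\le n\le N}\bigl(\|\phi^n\|_{\ell^\infty}+\|\nabla_G\phi^n\|_{\ell^\infty(E)}\bigr)\le C_T.$$ (2) There exist $\tau_0>0$ and $\widetilde C_T>0$, independent of $N$ and $\tau$, such that for $0<\tau\le\tau_0$ $$\max_{0\le n\le N}\bigl(\|\rho(t_n)-\rho^n\|+\|\phi(t_n)-\phi^n\|\bigr)+\Bigl(\tau\sum_{n=0}^{N-1}\|\nabla_G\phi(t_n)-\nabla_G\phi^n\|_E^2\Bigr)^{1/2}\le\widetilde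 C_T\,\tau,$$ where $(\phi,\rho)$ is the exact solution of the continuous mean field game system given in the context.
   Context: Graph notation. $G=(V,E,\omega)$ is a finite connected undirected graph without self-loops, $V=\{1,\dots,d\}$, $d\ge2$; $E\subset V\times V$ contains both orientations of each edge; $\omega=(\omega_{ij})$ is symmetric with $\omega_{ij}>0$ for $(i,j)\in E$ and $\omega_{ij}=0$ otherwise; $j\sim i$ means $(i,j)\in E$. On $\mathbb R^d$: $(x,y)=\sum_i x_iy_i$, $\|x\|=(x,x)^{1/2}$, $\|x\|_{\ell^\infty}=\max_i|x_i|$. $\mathbb S^{d\times d}$ is the space of skew-symmetric matrices $p$ with $p_{ij}=0$ for $(i,j)\notin E$, with $(p,q)_E=\frac12\sum_{(i,j)\in E}p_{ij}q_{ij}$, $\|p\|_E=(p,p)_E^{1/2}$, $\|p\|_{\ell^\infty(E)}=\max_{(i,j)\in E}|p_{ij}|$. Define $(\nabla_Gu)_{ij}=\sqrt{\omega_{ij}}(u_i-u_j)$, $(\operatorname{div}_Gq)_i=-\sum_{j\sim i}\sqrt{\omega_{ij}}\,q_{ij}$, $\Delta_G=\operatorname{div}_G\nabla_G$, i.e. $(\Delta_Gu)_i=\sum_{j\sim i}\omega_{ij}(u_j-u_i)$. $\mathcal P(G)=\{\xi\in[0,1]^d:\sum_i\xi_i=1\}$, $\mathcal P^\circ(G)=\{\xi\in\mathcal P(G):\xi_i>0\ \forall i\}$, $\mathcal P_\epsilon=\{\xi\in\mathcal P(G):\xi_i\ge\epsilon\ \forall i\}$, $\mathbb R_0^d=\{\eta\in\mathbb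 R^d:\sum_i\eta_i=0\}$. $D_\rho,D_p$ are Fréchet derivatives in the indicated variables (density directions are in $\mathbb R^d_0$). $T>0$ is fixed. Problem data: $\boldsymbol H:\mathcal P^\circ(G)\times\mathbb S^{d\times d}\to\mathbb R^d$, $\boldsymbol B:\mathcal P^\circ(G)\times\mathbb S^{d\times d}\to\mathbb S^{d\times d}$, $g:\mathcal P(G)\to\mathbb R^d$. Assumption (A). $\boldsymbol H,\boldsymbol B$ are $C^1$ on $\mathcal P^\circ(G)\times\mathbb S^{d\times d}$ and $g$ is $C^1$ on $\mathcal P(G)$. There are constants $C_0,C_H,C_g\ge0$ with $(\boldsymbol B(\rho,p),p)_E\ge(\boldsymbol H(\rho,p),\rho)-C_0$, $\boldsymbol H_i(\rho,p)\ge-C_H$, $\|g(\rho)\|_{\ell^\infty}\le C_g$ for all arguments. There is a locally bounded function $\mathfrak a:(0,\infty)\times\mathbb S^{d\times d}\to[0,\infty)$ with $|\boldsymbol B_{ij}(\rho,p)|\le(\rho_i+\rho_j)\,\mathfrak a(\rho_j/\rho_i,p)$ for $(i,j)\in E$, and $\mathfrak a(u,p)\to0$ as $u\to0^+$ or $u\to\infty$, locally uniformly in $p$. Assumption (B). $(g(\rho)-g(\sigma),\rho-\sigma)\ge0$ for all $\rho,\sigma\in\mathcal P^\circ(G)$. Moreover, for all $(\rho,p)\in\mathcal P^\circ(G)\times\mathbb S^{d\times d}$ and $(\eta,r)\in\mathbb R_0^d\times\mathbb S^{d\times d}$ with $(\eta,r)\neq(0,0)$, $$(D_\rho\boldsymbol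 H(\rho,p)[\eta]+D_p\boldsymbol H(\rho,p)[r],\eta)-(D_\rho\boldsymbol B(\rho,p)[\eta]+D_p\boldsymbol B(\rho,p)[r],r)_E<0.$$ Exact solution. The continuous system is $\dot\phi=\boldsymbol H(\rho,\nabla_G\phi)-\Delta_G\phi$, $\dot\rho=\operatorname{div}_G\boldsymbol B(\rho,\nabla_G\phi)+\Delta_G\rho$ on $[0,T]$, $\rho(0)=\rho_0$, $\phi(T)=g(\rho(T))$. Under (A), (B) and $\rho_0\in\mathcal P_\epsilon$ it is known to have a unique solution $(\phi,\rho)\in C^2([0,T];\mathbb R^d\times\mathcal P^\circ(G))$, and there are $\delta_*,C_*>0$ depending on $G,T,\epsilon$ and the problem data with $\min_t\min_i\rho_i(t)\ge\delta_*$ and $\|\phi\|_{C^2([0,T])}+\|\rho\|_{C^2([0,T])}\le C_*$. *)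

(* Defs.v *)
From HB Require Import structures.
From mathcomp Require Import all_boot all_order all_algebra.
From mathcomp Require Import all_classical all_reals all_analysis.

Set Implicit Arguments.
Unset Strict Implicit.
Unset Printing Implicit Defensive.

Import Order.TTheory GRing.Theory Num.Theory.
Import numFieldNormedType.Exports.

Local Open Scope classical_set_scope.
Local Open Scope ring_scope.

(** The densities live in the simplex and the momenta in a space of
    skew-symmetric matrices; neither is open in the ambient matrix space, so
    the library's derivatives at a point do not apply to functions that are
    meaningful on these sets only.  Functions are total, but the notions
    below depend only on the values of [f] on [D]. *)

(** Fréchet derivative of [f] at [x] relative to [D].  [L] is determined only
    on the span of the directions tangent to [D] at [x]. *)
Definition is_fderiv (R : realType) (U W : normedModType R) (D : set U)
    (f : U -> W) (x : U) (L : {linear U -> W}) : Prop :=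
  continuous L /\
  forall e : R, 0 < e ->
    \forall y \near within D (nbhs x), `|f y - f x - L (y - x)| <= e * `|y - x|.

Definition fderiv (R : realType) (U W : normedModType R) (D : set U)
    (f : U -> W) (x : U) : {linear U -> W} :=
  get (is_fderiv D f x).

(** [V] is the (finite-dimensional) space of directions tangent to [D], so
    continuity of the derivative in operator norm is continuity in every
    direction [v] of [V]. *)
Definition C1_on (R : realType) (U W : normedModType R) (D V : set U)
    (f : U -> W) : Prop :=
  (forall x, D x -> exists L, is_fderiv D f x L) /\
  (forall v, V v -> {within D, continuous (fun x => fderiv D f x v)}).

(** [f'] is the derivative of [f] on the set of times [A]; it is one-sided at
    the end points of an interval. *)
Definition has_tderiv (R : realType) (W : normedModType R) (A : set R)
    (f f' : R -> W) : Prop :=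
  forall t, A t ->
    (s - t)^-1 *: (f s - f t) @[s --> within A t^'] --> f' t.

Definition C2_with (R : realType) (W : normedModType R) (A : set R)
    (f f' : R -> W) : Prop :=
  has_tderiv A f f' /\
  exists f'' : R -> W, has_tderiv A f' f'' /\ {within A, continuous f''}.

Record wgraph (R : realType) (d : nat) := WGraph {
  edge : rel 'I_d;
  weight : 'M[R]_d;
  edge_sym : symmetric edge;
  edge_irrefl : irreflexive edge;
  edge_connected : forall i j, connect edge i j;
  weight_sym : forall i j, weight i j = weight j i;
  weight_gt0 : forall i j, edge i j -> 0 < weight i j;
  weight_eq0 : forall i j, ~~ edge i j -> weight i j = 0 }.

Definition dotv (R : realType) (d : nat) (x y : 'rV[R]_d) : R :=
  \sum_i x 0 i * y 0 i.

Definition norm2 (R : realType) (d : nat) (x : 'rV[R]_d) : R :=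
  Num.sqrt (dotv x x).

Definition norm_sup (R : realType) (d : nat) (x : 'rV[R]_d) : R :=
  \big[Num.max/0]_i `|x 0 i|.

Section Graph.
Variables (R : realType) (d : nat) (G : wgraph R d).
Implicit Types (u rho : 'rV[R]_d) (p q : 'M[R]_d).

Definition skewE : set 'M[R]_d :=
  [set p | (forall i j, p j i = - p i j) /\
           (forall i j, ~~ edge G i j -> p i j = 0)].

Definition dotE p q : R :=
  2^-1 * \sum_(e : 'I_d * 'I_d | edge G e.1 e.2) p e.1 e.2 * q e.1 e.2.

Definition normE p : R := Num.sqrt (dotE p p).

Definition normE_sup p : R :=
  \big[Num.max/0]_(e : 'I_d * 'I_d | edge G e.1 e.2) `|p e.1 e.2|.

Definition gradG u : 'M[R]_d :=
  \matrix_(i, j) (Num.sqrt (weight G i j) * (u 0 i - u 0 j)).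

Definition divG q : 'rV[R]_d :=
  \row_i (- \sum_(j | edge G i j) Num.sqrt (weight G i j) * q i j).

Definition lapG u : 'rV[R]_d := divG (gradG u).

End Graph.

Definition simplex (R : realType) (d : nat) : set 'rV[R]_d :=
  [set xi | (forall i, 0 <= xi 0 i <= 1) /\ \sum_i xi 0 i = 1].

Definition simplex_int (R : realType) (d : nat) : set 'rV[R]_d :=
  [set xi | simplex xi /\ forall i, 0 < xi 0 i].

Definition simplex_eps (R : realType) (d : nat) (eps : R) : set 'rV[R]_d :=
  [set xi | simplex xi /\ forall i, eps <= xi 0 i].

Definition tangent0 (R : realType) (d : nat) : set 'rV[R]_d :=
  [set eta | \sum_i eta 0 i = 0].

Arguments simplex {R d}.
Arguments simplex_int {R d}.
Arguments tangent0 {R d}.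

Section MeanFieldGame.
Variables (R : realType) (d : nat) (G : wgraph R d).
Variables (H : 'rV[R]_d -> 'M[R]_d -> 'rV[R]_d).
Variables (B : 'rV[R]_d -> 'M[R]_d -> 'M[R]_d).
Variables (g : 'rV[R]_d -> 'rV[R]_d).

Definition phase : set ('rV[R]_d * 'M[R]_d) :=
  simplex_int `*` skewE G.

Definition phase_tangent : set ('rV[R]_d * 'M[R]_d) :=
  tangent0 `*` skewE G.

(** A neighbourhood [K] independent of [e] makes the limits in [u] locally
    uniform in [p]. *)
Definition flux_bound (a : R -> 'M[R]_d -> R) : Prop :=
  [/\ forall (u : R) (p : 'M[R]_d), 0 < u -> skewE G p -> 0 <= a u p,
      forall (u : R) (p : 'M[R]_d), 0 < u -> skewE G p ->
        exists M : R,
          \forall z \near (u, p), 0 < z.1 -> skewE G z.2 -> a z.1 z.2 <= M,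
      forall p, skewE G p -> exists2 K : set 'M[R]_d, nbhs p K &
        forall e : R, 0 < e -> \forall u \near 0^'+,
          forall q, K q -> skewE G q -> a u q <= e,
      forall p, skewE G p -> exists2 K : set 'M[R]_d, nbhs p K &
        forall e : R, 0 < e -> \forall u \near +oo,
          forall q, K q -> skewE G q -> a u q <= e &
      forall rho p, simplex_int rho -> skewE G p -> forall i j, edge G i j ->
        `|B rho p i j| <= (rho 0 i + rho 0 j) * a (rho 0 j / rho 0 i) p].

Record assumptionA : Prop := AssumptionA {
  A_B_skew : forall rho p, simplex_int rho -> skewE G p -> skewE G (B rho p);
  A_H_C1 : C1_on phase phase_tangent (fun x => H x.1 x.2);
  A_B_C1 : C1_on phase phase_tangent (fun x => B x.1 x.2);
  A_g_C1 : C1_on simplex tangent0 g;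
  A_coercive : exists2 C0 : R, 0 <= C0 &
    forall rho p, simplex_int rho -> skewE G p ->
      dotE G (B rho p) p >= dotv (H rho p) rho - C0;
  A_H_lower : exists2 CH : R, 0 <= CH &
    forall rho p, simplex_int rho -> skewE G p ->
      forall i, H rho p 0 i >= - CH;
  A_g_bounded : exists2 Cg : R, 0 <= Cg &
    forall rho, simplex rho -> norm_sup (g rho) <= Cg;
  A_flux : exists a, flux_bound a }.

Definition DrhoH rho p := fderiv simplex_int (fun s => H s p) rho.
Definition DpH rho p := fderiv (skewE G) (fun q => H rho q) p.
Definition DrhoB rho p := fderiv simplex_int (fun s => B s p) rho.
Definition DpB rho p := fderiv (skewE G) (fun q => B rho q) p.

Record assumptionB : Prop := AssumptionB {
  B_g_monotone : forall rho sigma, simplex_int rho -> simplex_int sigma ->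
    0 <= dotv (g rho - g sigma) (rho - sigma);
  B_strict : forall rho p, simplex_int rho -> skewE G p ->
    forall eta r, tangent0 eta -> skewE G r -> (eta, r) != (0, 0) ->
      dotv (DrhoH rho p eta + DpH rho p r) eta
      - dotE G (DrhoB rho p eta + DpB rho p r) r < 0 }.

(** Only the values at [n <= N] of the two sequences are relevant. *)
Record interior_solution (T : R) (rho0 : 'rV[R]_d) (N : nat)
    (phi rho : nat -> 'rV[R]_d) : Prop := InteriorSolution {
  scheme_rho0 : rho 0%N = rho0;
  scheme_phiN : phi N = g (rho N);
  scheme_phi : forall n, (n < N)%N ->
    (T / N%:R)^-1 *: (phi n.+1 - phi n) =
    H (rho n.+1) (gradG G (phi n)) - lapG G (phi n);
  scheme_rho : forall n, (n < N)%N ->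
    (T / N%:R)^-1 *: (rho n.+1 - rho n) =
    divG G (B (rho n.+1) (gradG G (phi n))) + lapG G (rho n.+1);
  scheme_interior : forall n, (n <= N)%N -> simplex_int (rho n) }.

Definition exact_solution (T : R) (rho0 : 'rV[R]_d)
    (phi rho : R -> 'rV[R]_d) : Prop :=
  exists dphi drho : R -> 'rV[R]_d,
    C2_with `[0, T] phi dphi /\ C2_with `[0, T] rho drho /\
    (forall t : R, t \in `[0, T] ->
      [/\ simplex_int (rho t),
          dphi t = H (rho t) (gradG G (phi t)) - lapG G (phi t) &
          drho t = divG G (B (rho t) (gradG G (phi t))) + lapG G (rho t)]) /\
    rho 0 = rho0 /\ phi T = g (rho T).

End MeanFieldGame.

(* Main.v *)
Require Import Defs.
From HB Require Import structures.
From mathcomp Require Import all_boot all_order all_algebra.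
From mathcomp Require Import all_classical all_reals all_analysis.
From mathcomp Require Import ring lra.

Set Implicit Arguments.
Unset Strict Implicit.
Unset Printing Implicit Defensive.

Import Order.TTheory GRing.Theory Num.Theory.
Import numFieldNormedType.Exports.

Local Open Scope classical_set_scope.
Local Open Scope ring_scope.

(** Everything rests on one duality.  Test the equation for [phi] against the
    density and the equation for [rho] against [phi]: the Laplacians cancel, and
    the pairing of [phi] with [rho] grows at the rate given by the pairing of
    [H] with [rho] minus that of [B] with the gradient of [phi]
    ([duality_rate], [duality_step]).

    A priori bounds.  The lower bound of [H] and the maximum principle bound
    [phi] from above.  By coercivity the duality bounds the average of [phi] at
    time 0 from below; there the density is at least [eps] at every vertex, so
    every entry of [phi] at time 0 is bounded below, and a forward Gronwall
    estimate, blind to the density, carries the bound to all times.  Hence the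
    momenta stay in a compact set.  On such a set the flux out of a vertex of
    least density is either absorbed by diffusion, when the neighbour is much
    denser, or bounded by a multiple of the least density ([flux_compact]), so
    the least density decays at most exponentially.  The same steps apply to the
    scheme ([scheme_a_priori]) and to the exact solution ([exact_a_priori]); for
    the latter the differential inequalities are read off at a minimum over
    vertices and time ([family_minimum]).

    Stability.  All trajectories thus live in one compact convex set, on which
    the strict pointwise monotonicity becomes uniform, because the unit sphere
    of tangent directions is compact too, and integrates along segments
    ([mono_form_coercive], [HB_monotone]).  For the difference of two
    trajectories, possibly with residuals, the duality identity telescopes to a
    sum of negative squares plus terms linear in the residuals, while the two
    end terms have a sign: the initial densities agree and [g] is monotone.  The
    residual of the density equation has mass zero, so it sees [phi] only
    through its gradient ([poincare_tangent0]).  Hence the error is linear in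
    the residuals, first in l2 over time and then pointwise through the
    equations ([stability]).

    Residual zero is uniqueness.  The exact solution sampled at the nodes has
    residuals of order one in the time step ([consistency]), which is the error
    estimate; its constants depend on [eps] but not on the initial density,
    since [exact_a_priori] does not. *)

(** * Calculus on a weighted graph *)

Section DotProducts.
Variables (R : realType) (d : nat) (G : wgraph R d).
Implicit Types (u v w : 'rV[R]_d) (p q r : 'M[R]_d).

Lemma dotvC u v : dotv u v = dotv v u.
Proof. by apply: eq_bigr => i _; rewrite mulrC. Qed.

Lemma dotvDl u v w : dotv (u + v) w = dotv u w + dotv v w.
Proof.
by rewrite -big_split; apply: eq_bigr => i _; rewrite !mxE mulrDl.
Qed.

Lemma dotvZl a u v : dotv (a *: u) v = a * dotv u v.
Proof. by rewrite mulr_sumr; apply: eq_bigr => i _; rewrite !mxE mulrA. Qed.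

Lemma dotvNl u v : dotv (- u) v = - dotv u v.
Proof. by rewrite -scaleN1r dotvZl mulN1r. Qed.

Lemma dotvBl u v w : dotv (u - v) w = dotv u w - dotv v w.
Proof. by rewrite dotvDl dotvNl. Qed.

Lemma dotvDr u v w : dotv w (u + v) = dotv w u + dotv w v.
Proof. by rewrite !(dotvC w) dotvDl. Qed.

Lemma dotvZr a u v : dotv u (a *: v) = a * dotv u v.
Proof. by rewrite !(dotvC u) dotvZl. Qed.

Lemma dotvBr u v w : dotv w (u - v) = dotv w u - dotv w v.
Proof. by rewrite !(dotvC w) dotvBl. Qed.

Lemma dotEC p q : dotE G p q = dotE G q p.
Proof. by congr (_ * _); apply: eq_bigr => i _; rewrite mulrC. Qed.

Lemma dotEDl p q r : dotE G (p + q) r = dotE G p r + dotE G q r.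
Proof.
rewrite -mulrDr -big_split; congr (_ * _).
by apply: eq_bigr => i _; rewrite !mxE mulrDl.
Qed.

Lemma dotEZl a p q : dotE G (a *: p) q = a * dotE G p q.
Proof.
rewrite mulrCA mulr_sumr; congr (_ * _).
by apply: eq_bigr => i _; rewrite !mxE mulrA.
Qed.

Lemma dotENl p q : dotE G (- p) q = - dotE G p q.
Proof. by rewrite -scaleN1r dotEZl mulN1r. Qed.

Lemma dotEBl p q r : dotE G (p - q) r = dotE G p r - dotE G q r.
Proof. by rewrite dotEDl dotENl. Qed.

Lemma dotEZr a p q : dotE G p (a *: q) = a * dotE G p q.
Proof. by rewrite !(dotEC p) dotEZl. Qed.

Lemma dotE_sum p q :
  dotE G p q = 2^-1 * \sum_i \sum_(j | edge G i j) p i j * q i j.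
Proof. by congr (_ * _); rewrite pair_big_dep. Qed.

End DotProducts.

Section SupNorm.
Variable R : realType.

Lemma entryD m n (A B : 'M[R]_(m, n)) i j : (A + B) i j = A i j + B i j.
Proof. by rewrite !mxE. Qed.

Lemma entryB m n (A B : 'M[R]_(m, n)) i j : (A - B) i j = A i j - B i j.
Proof. by rewrite !mxE. Qed.

Lemma entryZ m n (a : R) (A : 'M[R]_(m, n)) i j : (a *: A) i j = a * A i j.
Proof. by rewrite !mxE. Qed.

Lemma ler_mx_entry m n (A : 'M[R]_(m, n)) i j : `|A i j| <= `|A|.
Proof.
rewrite [leRHS]/Num.norm/= mx_normrE.
exact: (le_bigmax _ (fun ij : 'I_m * 'I_n => `|A ij.1 ij.2|) (i, j)).
Qed.

Lemma mx_norm_le m n (A : 'M[R]_(m, n)) c :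
  0 <= c -> (forall i j, `|A i j| <= c) -> `|A| <= c.
Proof.
move=> c0 Ac; rewrite [leLHS]/Num.norm/= mx_normrE.
by apply/bigmax_leP; split => // -[i j] _; exact: Ac.
Qed.

Lemma rV_norm_le n (u : 'rV[R]_n) c :
  0 <= c -> (forall i, `|u 0 i| <= c) -> `|u| <= c.
Proof. by move=> c0 uc; apply: mx_norm_le => // i j; rewrite ord1. Qed.

Lemma norm_sup_le n (u : 'rV[R]_n) : norm_sup u <= `|u|.
Proof. by apply/bigmax_leP; split => // i _; exact: ler_mx_entry. Qed.

Lemma le_norm_sup n (u : 'rV[R]_n) : `|u| <= norm_sup u.
Proof.
apply: rV_norm_le => [|i]; first exact: bigmax_ge_id.
exact: (le_bigmax _ (fun i => `|u 0 i|)).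
Qed.

Lemma normE_sup_le n (G : wgraph R n) (p : 'M[R]_n) : normE_sup G p <= `|p|.
Proof. by apply/bigmax_leP; split => // i _; exact: ler_mx_entry. Qed.

Lemma dotv_le n (u v : 'rV[R]_n) : `|dotv u v| <= n%:R * `|u| * `|v|.
Proof.
apply: (le_trans (ler_norm_sum _ _ _)).
have -> : n%:R * `|u| * `|v| = \sum_(i < n) `|u| * `|v|.
  by rewrite sumr_const card_ord -mulrA mulr_natl.
by apply: ler_sum => i _; rewrite normrM ler_pM// ler_mx_entry.
Qed.

Lemma norm2_le n (u : 'rV[R]_n) : norm2 u <= n%:R * `|u|.
Proof.
rewrite -(@ger0_norm _ (n%:R * _)) ?mulr_ge0// -sqrtr_sqr ler_sqrt ?sqr_ge0//.
apply: le_trans (ler_norm _) _; apply: le_trans (dotv_le _ _) _.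
rewrite exprMn expr2 -mulrA -expr2; apply: ler_wpM2r; first exact: sqr_ge0.
by case: n {u} => [|n]; rewrite ?mulr0// ler_peMr// ler1n.
Qed.

Lemma dotE_le n (G : wgraph R n) (p q : 'M[R]_n) :
  `|dotE G p q| <= n%:R ^+ 2 * `|p| * `|q|.
Proof.
rewrite normrM ger0_norm ?invr_ge0//.
apply: (@le_trans _ _ (\sum_(e : 'I_n * 'I_n) `|p| * `|q|)); last first.
  by rewrite sumr_const card_prod card_ord -mulrA -natrX mulr_natl.
apply: (@le_trans _ _ (1 * `|\sum_(e | edge G e.1 e.2) p e.1 e.2 * q e.1 e.2|)).
  by apply: ler_wpM2r => //; rewrite invf_le1// ler1n.
rewrite mul1r; apply: (le_trans (ler_norm_sum _ _ _)).
rewrite [leRHS](bigID (fun e => edge G e.1 e.2))/=.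
rewrite -[leLHS]addr0; apply: lerD; last first.
  by apply: sumr_ge0 => e _; rewrite mulr_ge0.
by apply: ler_sum => e _; rewrite normrM ler_pM// ler_mx_entry.
Qed.

Lemma normE_le n (G : wgraph R n) (p : 'M[R]_n) : normE G p <= n%:R * `|p|.
Proof.
rewrite -(@ger0_norm _ (n%:R * _)) ?mulr_ge0// -sqrtr_sqr ler_sqrt ?sqr_ge0//.
apply: le_trans (ler_norm _) _; apply: le_trans (dotE_le _ _ _) _.
by rewrite exprMn -mulrA -expr2.
Qed.

End SupNorm.

Section GraphCalculus.
Variables (R : realType) (d : nat) (G : wgraph R d).
Implicit Types (u v : 'rV[R]_d) (p q : 'M[R]_d).

Lemma weight_ge0 i j : 0 <= weight G i j.
Proof.
have [ij|nij] := boolP (edge G i j); first exact/ltW/weight_gt0.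
by rewrite weight_eq0.
Qed.

Lemma gradGB u v : gradG G (u - v) = gradG G u - gradG G v.
Proof. by apply/matrixP => i j; rewrite !mxE; ring. Qed.

Lemma divGB p q : divG G (p - q) = divG G p - divG G q.
Proof.
apply/rowP => i; rewrite !mxE -opprD -sumrB; congr (- _).
by apply: eq_bigr => j _; rewrite !mxE mulrBr.
Qed.

Lemma lapGB u v : lapG G (u - v) = lapG G u - lapG G v.
Proof. by rewrite /lapG gradGB divGB. Qed.

Lemma lapGE u i :
  lapG G u 0 i = \sum_(j | edge G i j) weight G i j * (u 0 j - u 0 i).
Proof.
rewrite mxE -sumrN; apply: eq_bigr => j _.
by rewrite mxE mulrA -expr2 sqr_sqrtr ?weight_ge0// -mulrN opprB.
Qed.

Lemma lapG_max u i : (forall j, u 0 j <= u 0 i) -> lapG G u 0 i <= 0.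
Proof.
move=> ui; rewrite lapGE; apply: sumr_le0 => j _.
by rewrite mulr_ge0_le0 ?weight_ge0// subr_le0.
Qed.

Lemma skewE_gradG u : skewE G (gradG G u).
Proof.
split=> [i j|i j nij]; rewrite !mxE; first by rewrite weight_sym -mulrN opprB.
by rewrite weight_eq0// sqrtr0 mul0r.
Qed.

Lemma skewEB p q : skewE G p -> skewE G q -> skewE G (p - q).
Proof.
move=> [p1 p2] [q1 q2]; split=> [i j|i j nij]; rewrite !mxE.
  by rewrite p1 q1 -opprD.
by rewrite p2// q2// subr0.
Qed.

Lemma dotv_divG u q : skewE G q -> dotv u (divG G q) = - dotE G (gradG G u) q.
Proof.
move=> [qN _]; rewrite dotE_sum.
pose S := \sum_i \sum_(j | edge G i j) Num.sqrt (weight G i j) * u 0 i * q i j.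
have -> : dotv u (divG G q) = - S.
  rewrite /dotv /S -sumrN; apply: eq_bigr => i _.
  rewrite mxE mulrN mulr_sumr; congr (- _).
  by apply: eq_bigr => j _; rewrite mulrCA mulrA.
have SE : \sum_i \sum_(j | edge G i j) Num.sqrt (weight G i j) * u 0 j * q i j
    = - S.
  rewrite (exchange_big_dep xpredT)//= /S -sumrN; apply: eq_bigr => i _.
  rewrite -sumrN; apply: eq_big => [j|j _]; first exact: edge_sym.
  by rewrite qN weight_sym mulrN.
have -> : \sum_i \sum_(j | edge G i j) gradG G u i j * q i j = S - - S.
  rewrite -SE -sumrB; apply: eq_bigr => i _.
  by rewrite -sumrB; apply: eq_bigr => j _; rewrite mxE mulrBr mulrBl.
by field.
Qed.

Lemma lapG_sym u v : dotv u (lapG G v) = dotv (lapG G u) v.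
Proof.
rewrite [RHS]dotvC /lapG !dotv_divG; try exact: skewE_gradG.
by rewrite dotEC.
Qed.

Lemma sum_divG q : skewE G q -> \sum_i divG G q 0 i = 0.
Proof.
move=> qs; have := dotv_divG (const_mx 1) qs.
rewrite (_ : gradG G (const_mx 1) = 0); last first.
  by apply/matrixP => i j; rewrite !mxE subrr mulr0.
have -> : dotE G 0 q = 0 by rewrite -(scale0r q) dotEZl mul0r.
rewrite oppr0 => {2}<-.
by apply: eq_bigr => i _; rewrite [const_mx 1 _ _]mxE mul1r.
Qed.

(** Up to numerical factors, a bound for the norms of [gradG] and [divG] as
    operators between sup-normed spaces. *)
Definition opnorm_graph : R := \sum_i \sum_j Num.sqrt (weight G i j).

Lemma opnorm_graph_ge0 : 0 <= opnorm_graph.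
Proof. by apply: sumr_ge0 => i _; apply: sumr_ge0 => j _; exact: sqrtr_ge0. Qed.

Lemma sqrt_weight_le i j : Num.sqrt (weight G i j) <= opnorm_graph.
Proof.
rewrite /opnorm_graph (bigD1 i)//= (bigD1 j)//= -addrA lerDl addr_ge0//.
  by apply: sumr_ge0 => k _; exact: sqrtr_ge0.
by apply: sumr_ge0 => k _; apply: sumr_ge0 => l _; exact: sqrtr_ge0.
Qed.

Lemma gradG_le u : `|gradG G u| <= 2 * opnorm_graph * `|u|.
Proof.
have w0 := opnorm_graph_ge0; apply: mx_norm_le => [|i j].
  by rewrite !mulr_ge0.
rewrite mxE normrM ger0_norm ?sqrtr_ge0// (mulrC 2) -mulrA.
apply: ler_pM; rewrite ?sqrtr_ge0// ?sqrt_weight_le//.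
apply: le_trans (ler_normB _ _) _.
by rewrite mulrDl mul1r lerD// ler_mx_entry.
Qed.

Lemma divG_le q : `|divG G q| <= opnorm_graph * `|q|.
Proof.
have w0 := opnorm_graph_ge0; apply: rV_norm_le => [|i].
  by rewrite mulr_ge0.
rewrite mxE normrN; apply: (le_trans (ler_norm_sum _ _ _)).
apply: (@le_trans _ _ (\sum_j Num.sqrt (weight G i j) * `|q|)).
  rewrite [leRHS](bigID (fun j => edge G i j))/= -[leLHS]addr0; apply: lerD.
    apply: ler_sum => j _; rewrite normrM ger0_norm ?sqrtr_ge0//.
    by rewrite ler_wpM2l ?sqrtr_ge0// ler_mx_entry.
  by apply: sumr_ge0 => j _; rewrite mulr_ge0// sqrtr_ge0.
rewrite -mulr_suml ler_wpM2r// /opnorm_graph [leRHS](bigD1 i)//= lerDl.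
by apply: sumr_ge0 => k _; apply: sumr_ge0 => l _; exact: sqrtr_ge0.
Qed.

Lemma lapG_le u : `|lapG G u| <= 2 * opnorm_graph ^+ 2 * `|u|.
Proof.
apply: le_trans (divG_le _) _.
rewrite expr2 mulrCA -mulrA; apply: ler_wpM2l; first exact: opnorm_graph_ge0.
exact: gradG_le.
Qed.

(** Walk along a path: each edge costs one entry of the gradient. *)
Lemma poincare_vertex i j : exists2 c : R, 0 <= c &
  forall u, `|u 0 i - u 0 j| <= c * `|gradG G u|.
Proof.
have /connectP[p] := edge_connected G i j.
elim: p i => [|k p IH] i /= => [_ ->|/andP[ik kp] jE].
  by exists 0 => // u; rewrite subrr normr0 mul0r.
have [c c0 cP] := IH k kp jE.
have s0 : 0 < Num.sqrt (weight G i k) by rewrite sqrtr_gt0 weight_gt0.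
exists ((Num.sqrt (weight G i k))^-1 + c) => [|u].
  by rewrite addr_ge0// invr_ge0 sqrtr_ge0.
rewrite -(subrKA (u 0 k)) mulrDl; apply: le_trans (ler_normD _ _) _.
apply: lerD => //; rewrite ler_pdivlMl//.
have := ler_mx_entry (gradG G u) i k.
by rewrite mxE normrM ger0_norm// ltW.
Qed.

(** Directions of total mass zero do not see constants, so pairing them with
    [u] costs only the gradient of [u]; this is where connectedness enters. *)
Lemma poincare_tangent0 : exists2 c : R, 0 <= c &
  forall u v, tangent0 v -> `|dotv u v| <= c * `|gradG G u| * `|v|.
Proof.
have [d0|[i0]] : d = 0%N \/ inhabited 'I_d.
  by case: (d) => [|n]; [left|right; exists; exact: ord0].
  exists 0 => // u v _; rewrite /dotv !mul0r big1 ?normr0// => i.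
  by have := ltn_ord i; rewrite [X in (_ < X)%N]d0.
have /choice[c cP] : forall i, exists c : R, 0 <= c /\
    forall u, `|u 0 i - u 0 i0| <= c * `|gradG G u|.
  by move=> i; have [c c0 cP] := poincare_vertex i i0; exists c.
exists (\sum_i c i) => [|u v v0].
  by apply: sumr_ge0 => i _; have [] := cP i.
have -> : dotv u v = \sum_i (u 0 i - u 0 i0) * v 0 i.
  rewrite (eq_bigr (fun i => u 0 i * v 0 i - u 0 i0 * v 0 i)).
    by rewrite sumrB -mulr_sumr v0 mulr0 subr0.
  by move=> i _; rewrite mulrBl.
apply: (le_trans (ler_norm_sum _ _ _)); rewrite !mulr_suml.
apply: ler_sum => i _; rewrite normrM ler_pM// ?ler_mx_entry//.
by have [] := cP i.
Qed.

(** Each half of the system, tested against the unknown of the other half: the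
    Laplacian contributions cancel and only [H], [B] and the residual survive.
    The energy and stability estimates all rest on this identity. *)
Lemma duality_rate u r h q b : skewE G q ->
  dotv (h - lapG G u) r + dotv u (divG G q + lapG G r + b) =
  dotv h r - dotE G q (gradG G u) + dotv u b.
Proof.
by move=> qs; rewrite dotvBl !dotvDr lapG_sym dotv_divG// dotEC; ring.
Qed.

(** The splitting of the increment that telescopes: [phi] moves against the new
    density, the density against the old [phi], which is how the scheme couples
    its two halves. *)
Lemma duality_step (tau : R) u u' r r' h q b : skewE G q ->
  u' - u = tau *: (h - lapG G u) ->
  r' - r = tau *: (divG G q + lapG G r' + b) ->
  dotv u' r' - dotv u r =
  tau * (dotv h r' - dotE G q (gradG G u) + dotv u b).
Proof.
move=> qs uE rE.
have -> : dotv u' r' - dotv u r = dotv (u' - u) r' + dotv u (r' - r).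
  by rewrite dotvBl dotvBr; ring.
by rewrite uE rE dotvZl dotvZr -mulrDr duality_rate.
Qed.

End GraphCalculus.

(** * Time derivatives and minimum principles *)

Section TimeDerivatives.
Variable R : realType.
Implicit Types (A : set R) (f g : R -> R).

Lemma has_tderiv_subset (W : normedModType R) (A A' : set R) (f f' : R -> W) :
  A' `<=` A -> has_tderiv A f f' -> has_tderiv A' f f'.
Proof.
move=> sAA' df t A't; apply: (cvg_trans _ (df t (sAA' _ A't))).
by apply: cvg_app; apply: within_subset.
Qed.

(** The scalar case of [has_tderiv], stated with a quotient so that the limit
    laws of the field [R] apply. *)
Definition has_rderiv A f f' := forall t, A t ->
  (f s - f t) / (s - t) @[s --> within A t^'] --> f' t.

Lemma has_rderiv_subset A A' f f' :
  A' `<=` A -> has_rderiv A f f' -> has_rderiv A' f f'.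
Proof.
move=> sAA' df t A't; apply: (cvg_trans _ (df t (sAA' _ A't))).
by apply: cvg_app; apply: within_subset.
Qed.

Lemma has_rderiv_ext A f f1 f' f1' :
  (forall t, A t -> f t = f1 t) -> (forall t, A t -> f' t = f1' t) ->
  has_rderiv A f f' -> has_rderiv A f1 f1'.
Proof.
move=> ff1 ff1' df t At; rewrite -ff1'//.
apply: (cvg_trans _ (df t At)); apply: near_eq_cvg.
near=> s; have As : A s by near: s; exact: withinT.
by rewrite /= !ff1.
Unshelve. all: by end_near. Qed.

Lemma has_rderiv_cvg A f f' t :
  has_rderiv A f f' -> A t -> f s @[s --> within A t^'] --> f t.
Proof.
move=> df At.
have sub0 : s - t @[s --> within A t^'] --> 0.
  rewrite -(subrr t); apply: cvgB; last exact: cvg_cst.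
  by apply: cvg_within_filter; exact: cvg_within.
have : (f s - f t) / (s - t) * (s - t) + f t @[s --> within A t^'] --> f t.
  rewrite -[X in _ --> X]add0r -(mulr0 (f' t)).
  by apply: cvgD; [apply: cvgM => //; exact: df|exact: cvg_cst].
apply: cvg_trans; apply: near_eq_cvg.
near=> s => /=; rewrite mulfVK ?subrK// subr_eq0.
by near: s; apply: cvg_within; exact: withinT.
Unshelve. all: by end_near. Qed.

Lemma has_rderiv_continuous A f f' : has_rderiv A f f' ->
  {within A, continuous f}.
Proof.
move=> df; apply/subspace_continuousP => t At.
have fc := has_rderiv_cvg df At.
move=> P fP; have : within A t^' (f @^-1` P) := fc _ fP.
rewrite /within/= /dnbhs/within/= nearE/= => PA.
apply: filterS PA => s PA As.
have [->|st] := eqVneq s t; first exact: (nbhs_singleton fP).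
exact: PA.
Qed.

Lemma has_tderiv_entry m n A (f f' : R -> 'M[R]_(m, n)) i j :
  has_tderiv A f f' -> has_rderiv A (fun t => f t i j) (fun t => f' t i j).
Proof.
move=> df t At.
have : ((s - t)^-1 *: (f s - f t)) i j @[s --> within A t^'] --> f' t i j.
  exact: (cvg_comp _ _ (df t At) (@coord_continuous R m n i j _)).
apply: cvg_trans; apply: near_eq_cvg; near=> s.
by rewrite /= !mxE mulrC.
Unshelve. all: by end_near. Qed.

Lemma has_rderiv_cst A (c : R) : has_rderiv A (fun=> c) (fun=> 0).
Proof.
move=> t At; rewrite (_ : (fun _ => _) = fun=> 0); first exact: cvg_cst.
by apply/funext => s; rewrite subrr mul0r.
Qed.

Lemma has_rderiv_id A : has_rderiv A id (fun=> 1).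
Proof.
move=> t At; have : (1 : R) @[_ --> within A t^'] --> (1 : R) by exact: cvg_cst.
apply: cvg_trans; apply: near_eq_cvg; near=> s => /=.
rewrite mulfV// subr_eq0.
by near: s; apply: cvg_within; exact: withinT.
Unshelve. all: by end_near. Qed.

Lemma has_rderivD A f f' g g' : has_rderiv A f f' -> has_rderiv A g g' ->
  has_rderiv A (fun t => f t + g t) (fun t => f' t + g' t).
Proof.
move=> df dg t At; have /(_ _) := cvgD (df t At) (dg t At).
by apply: cvg_trans; apply: near_eq_cvg; near=> s; rewrite ?fctE/=; ring.
Unshelve. all: by end_near. Qed.

Lemma has_rderivM A f f' g g' : has_rderiv A f f' -> has_rderiv A g g' ->
  has_rderiv A (fun t => f t * g t) (fun t => f' t * g t + f t * g' t).
Proof.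
move=> df dg t At.
have : (f s - f t) / (s - t) * g s + f t * ((g s - g t) / (s - t))
    @[s --> within A t^'] --> f' t * g t + f t * g' t.
  apply: cvgD; apply: cvgM.
  - exact: df.
  - exact: has_rderiv_cvg dg At.
  - exact: cvg_cst.
  - exact: dg.
by apply: cvg_trans; apply: near_eq_cvg; near=> s; rewrite ?fctE/=; ring.
Unshelve. all: by end_near. Qed.

Lemma has_rderivZ A (c : R) f f' : has_rderiv A f f' ->
  has_rderiv A (fun t => c * f t) (fun t => c * f' t).
Proof.
move=> df; have := has_rderivM (has_rderiv_cst c) df.
by apply: has_rderiv_ext => t _; rewrite ?mul0r ?add0r.
Qed.

Lemma has_rderivB A f f' g g' : has_rderiv A f f' -> has_rderiv A g g' ->
  has_rderiv A (fun t => f t - g t) (fun t => f' t - g' t).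
Proof.
move=> df /(has_rderivZ (c := -1)) dg; have := has_rderivD df dg.
by apply: has_rderiv_ext => t _; rewrite mulN1r.
Qed.

Lemma has_rderiv_sum A (I : finType) (P : pred I) (f f' : I -> R -> R) :
  (forall i, has_rderiv A (f i) (f' i)) ->
  has_rderiv A (fun t => \sum_(i | P i) f i t) (fun t => \sum_(i | P i) f' i t).
Proof.
move=> df t At.
have : \sum_(i | P i) ((f i s - f i t) / (s - t)) @[s --> within A t^']
    --> \sum_(i | P i) f' i t.
  by apply: cvg_big => [|i _]; [exact: add_continuous|exact: df].
apply: cvg_trans; apply: near_eq_cvg; near=> s.
by rewrite /= -sumrB mulr_suml.
Unshelve. all: by end_near. Qed.

Lemma has_rderiv_dotv A n (f f' g g' : R -> 'rV[R]_n) :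
  has_tderiv A f f' -> has_tderiv A g g' ->
  has_rderiv A (fun t => dotv (f t) (g t))
    (fun t => dotv (f' t) (g t) + dotv (f t) (g' t)).
Proof.
move=> df dg.
have := has_rderiv_sum (P := xpredT) (fun i => has_rderivM
  (has_tderiv_entry (i := 0) (j := i) df)
    (has_tderiv_entry (i := 0) (j := i) dg)).
by apply: has_rderiv_ext => t _ //; rewrite big_split.
Qed.

Lemma has_rderiv_exp A (c : R) :
  has_rderiv A (fun t => expR (c * t)) (fun t => c * expR (c * t)).
Proof.
move=> t At; apply: cvg_within_filter.
have [_ dE] : is_derive t 1 (fun t => expR (c * t)) (c * expR (c * t)).
  by apply: is_derive_eq; rewrite /GRing.scale/=; ring.
have /cvg_ex[l fl] : derivable (fun t => expR (c * t)) t 1.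
  by apply: ex_derive.
have lE : l = c * expR (c * t) by rewrite -dE; apply/esym/cvg_lim.
rewrite -lE => P lP.
have H : \forall h \near (0 : R), h != 0 ->
    P (h^-1 *: (expR (c * (h *: (1 : R) + t)) - expR (c * t))) := fl _ lP.
rewrite /= /dnbhs/within/= [nbhs _ _](near_shift 0 t)/=.
move: H; apply: filterS => h hP.
rewrite /= subr0 -subr_eq0 addrK => /hP.
by rewrite /= /GRing.scale/= mulr1 mulrC.
Qed.

Lemma within_itv_left (a b t : R) (P : R -> Prop) : a < t -> t <= b ->
  (\forall s \near within `[a, b] t^', P s) -> exists2 s, a <= s < t & P s.
Proof.
move=> at_ tb; rewrite !near_withinE => nP.
have /filter_ex[s [as_ st Ps]] : \forall s \near t^'-, [/\ a < s, s < t & P s].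
  near=> s; have as_ : a < s by near: s; exact: nbhs_left_gt.
  have st : s < t by near: s; exact: nbhs_left_lt.
  split=> //; suff : s != t -> `[a, b]%classic s -> P s.
    by apply; [rewrite lt_eqF|rewrite /= in_itv/= !ltW// (lt_le_trans st)].
  by near: s; apply: cvg_within; exact: nP.
by exists s; rewrite ?st ?ltW.
Unshelve. all: by end_near. Qed.

Lemma within_itv_right (a b t : R) (P : R -> Prop) : a <= t -> t < b ->
  (\forall s \near within `[a, b] t^', P s) -> exists2 s, t < s <= b & P s.
Proof.
move=> at_ tb; rewrite !near_withinE => nP.
have /filter_ex[s [sb ts Ps]] : \forall s \near t^'+, [/\ s < b, t < s & P s].
  near=> s; have sb : s < b by near: s; exact: nbhs_right_lt.
  have ts : t < s by near: s; exact: nbhs_right_gt.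
  split=> //; suff : s != t -> `[a, b]%classic s -> P s.
    by apply; [rewrite gt_eqF|rewrite /= in_itv/= !ltW// (le_lt_trans at_)].
  by near: s; apply: cvg_within; exact: nP.
by exists s; rewrite ?ts ?ltW.
Unshelve. all: by end_near. Qed.

(** At a minimum over a finite family and over time, the derivative has the
    sign forced by the side from which the minimum can be approached.  All the
    maximum principles and Gronwall estimates for the exact solution are read
    off from it. *)
Lemma family_minimum (I : finType) (i0 : I) (a b : R) (v v' : I -> R -> R) :
  a <= b -> (forall i, has_rderiv `[a, b] (v i) (v' i)) ->
  exists i t, [/\ t \in `[a, b], forall j s, s \in `[a, b] -> v i t <= v j s,
    (a < t -> v' i t <= 0) & (t < b -> 0 <= v' i t)].
Proof.
move=> ab dv.
have /choice[m mP] : forall i, exists t, t \in `[a, b] /\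
    forall s, s \in `[a, b] -> v i t <= v i s.
  by move=> i; have [t tI tP] := EVT_min ab (has_rderiv_continuous (dv i));
    exists t.
pose i := [arg min_(i < i0) v i (m i)]%O.
have iP j s : s \in `[a, b] -> v i (m i) <= v j s.
  move=> sab; apply: le_trans (proj2 (mP j) s sab).
  by rewrite /i; case: arg_minP => // k _; apply.
have [tab _] := mP i; set t := m i in iP tab *.
exists i, t; split=> //.
- move=> at_; rewrite leNgt; apply/negP => vt.
  have tb : t <= b by rewrite (itvP tab).
  have [s /andP[as_ st]] :=
    within_itv_left at_ tb (cvgr_gt _ (dv i t tab) _ vt).
  have sab : s \in `[a, b] by rewrite in_itv/= as_ (le_trans (ltW st)).
  by rewrite nmulr_lgt0 ?invr_lt0 ?subr_lt0// ltNge iP.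
- move=> tb; rewrite leNgt; apply/negP => vt.
  have at_ : a <= t by rewrite (itvP tab).
  have [s /andP[ts sb]] :=
    within_itv_right at_ tb (cvgr_lt _ (dv i t tab) _ vt).
  have sab : s \in `[a, b] by rewrite in_itv/= sb (le_trans at_ (ltW ts)).
  by rewrite pmulr_llt0 ?invr_gt0 ?subr_gt0// ltNge subr_ge0 iP.
Qed.

(** Subtract a line of slope slightly above [c]: the difference can only be
    minimal at the left end. *)
Lemma has_rderiv_le (a b c : R) f f' : a <= b -> has_rderiv `[a, b] f f' ->
  (forall t, t \in `[a, b] -> f' t <= c) -> f b - f a <= c * (b - a).
Proof.
move=> ab df fc; apply/ler_addgt0Pr => e e0.
pose k := c + e / (b - a + 1).
have ba1 : 0 < b - a + 1 by rewrite ltr_pwDr// subr_ge0.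
have dv : has_rderiv `[a, b] (fun t => k * t - f t) (fun t => k * 1 - f' t).
  exact/has_rderivB/df/has_rderivZ/has_rderiv_id.
have [_ [t [tab tmin tl _]]] := family_minimum tt ab (fun=> dv).
have ta : t = a.
  apply/eqP; rewrite eq_le (itvP tab) andbT leNgt; apply/negP => /tl.
  rewrite mulr1 subr_le0 leNgt; apply/negP/negPn;
    apply: le_lt_trans (fc t tab) _.
  by rewrite ltrDl divr_gt0.
have bab : b \in `[a, b] by rewrite in_itv/= lexx ab.
have := tmin tt b bab; rewrite ta => H.
have {H} : f b - f a <= k * (b - a) by rewrite mulrBr; lra.
move/le_trans; apply;
  rewrite mulrDl lerD2l -mulrA ger_pMr// mulrC ler_pdivrMr//.
by rewrite mul1r lerDl.
Qed.

End TimeDerivatives.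

(** * Derivatives relative to a set *)

Section RelativeDerivatives.
Variable R : realType.

Definition segment_pt (U : lmodType R) (y x : U) (s : R) : U := y + s *:
  (x - y).

Lemma segment_pt0 (U : lmodType R) (y x : U) : segment_pt y x 0 = y.
Proof. by rewrite /segment_pt scale0r addr0. Qed.

Lemma segment_pt1 (U : lmodType R) (y x : U) : segment_pt y x 1 = x.
Proof. by rewrite /segment_pt scale1r addrC subrK. Qed.

Lemma segment_ptB (U : lmodType R) (y x : U) s t :
  segment_pt y x s - segment_pt y x t = (s - t) *: (x - y).
Proof. by rewrite /segment_pt opprD addrACA subrr add0r -scalerBl. Qed.

Definition convex_set (U : lmodType R) (D : set U) :=
  forall x y s, D x -> D y -> s \in `[0, 1] -> D (segment_pt y x s).

Lemma segment_cvg (U : normedModType R) (y x : U) (t : R) (D : set U) :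
  (forall s, s \in `[0, 1] -> D (segment_pt y x s)) ->
  segment_pt y x s @[s --> within `[0, 1] t^'] -->
    within D (nbhs (segment_pt y x t)).
Proof.
move=> segD P; rewrite /within/= => DP.
have gc : segment_pt y x s @[s --> t^'] --> segment_pt y x t.
  apply: cvg_within_filter; apply: cvgD; first exact: cvg_cst.
  by apply: cvgZr_tmp; exact: cvg_id.
have := gc _ DP; rewrite /= !near_simpl/= /within/=.
by apply: filterS => s sDP s01; exact/sDP/segD.
Qed.

(** Chain rule along a segment, entry by entry: the scalar mean value inequality
    then controls the matrix norm, which is the largest entry. *)
Lemma fderiv_segment (U : normedModType R) m n (D : set U)
    (f : U -> 'M[R]_(m, n)) (y x : U) (L : {linear U -> 'M[R]_(m, n)}) (t : R)
      i j :
  (forall s, s \in `[0, 1] -> D (segment_pt y x s)) ->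
  is_fderiv D f (segment_pt y x t) L ->
  (f (segment_pt y x s) i j - f (segment_pt y x t) i j) / (s - t)
    @[s --> within `[0, 1] t^'] --> L (x - y) i j.
Proof.
move=> segD [_ Lf]; apply/cvgrPdist_le => e e0.
have xy0 : 0 < `|x - y| + 1 by rewrite ltr_wpDl.
have Lt : \forall s \near within `[0, 1] t^',
    `|f (segment_pt y x s) - f (segment_pt y x t)
      - L (segment_pt y x s - segment_pt y x t)|
    <= e / (`|x - y| + 1) * `|segment_pt y x s - segment_pt y x t|.
  exact: (segment_cvg segD (Lf _ (divr_gt0 e0 xy0))).
near=> s; have st : s != t by near: s; apply: cvg_within; exact: withinT.
have : `|f (segment_pt y x s) - f (segment_pt y x t)
    - L (segment_pt y x s - segment_pt y x t)|
    <= e / (`|x - y| + 1) * `|segment_pt y x s - segment_pt y x t| by near: s.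
rewrite segment_ptB linearZ normrZ => H.
have st0 : 0 < `|s - t| by rewrite normr_gt0 subr_eq0.
rewrite -(ler_pM2r st0) -normrM mulrBl mulfVK ?subr_eq0// distrC.
have := ler_mx_entry (f (segment_pt y x s) - f (segment_pt y x t)
  - (s - t) *: L (x - y)) i j.
rewrite !mxE (mulrC (L _ _ _)) => /le_trans; apply; apply: le_trans H _.
rewrite mulrCA [leRHS]mulrC ler_wpM2l// -mulrA ger_pMr// mulrC ler_pdivrMr//.
by rewrite mul1r lerDl.
Unshelve. all: by end_near. Qed.

(** Relative derivatives are only determined along the directions in which one
    can move inside [D]. *)
Lemma fderiv_unique (U : normedModType R) m n (D : set U)
    (f : U -> 'M[R]_(m, n)) (y x : U) (L1 L2 : {linear U -> 'M[R]_(m, n)}) :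
  (forall s, s \in `[0, 1] -> D (segment_pt y x s)) ->
  is_fderiv D f y L1 -> is_fderiv D f y L2 -> L1 (x - y) = L2 (x - y).
Proof.
move=> segD; rewrite -[y in is_fderiv _ _ y](segment_pt0 y x) => d1 d2.
apply/matrixP => i j.
have PF : ProperFilter (within `[0, 1] (0 : R)^').
  apply: Build_ProperFilter_ex => P nP.
  have [s _ Ps] := within_itv_right (lexx 0) ltr01 nP; by exists s.
have l1 := fderiv_segment (i := i) (j := j) segD d1.
have l2 := fderiv_segment (i := i) (j := j) segD d2.
exact (cvg_unique (@Rhausdorff R) l1 l2).
Qed.

Lemma fderivP (U W : normedModType R) (D : set U) (f : U -> W) x :
  (exists L, is_fderiv D f x L) -> is_fderiv D f x (fderiv D f x).
Proof. exact: getPex. Qed.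

Lemma has_rderiv_segment (U : normedModType R) m n (D V : set U)
    (f : U -> 'M[R]_(m, n)) (y x : U) i j : C1_on D V f ->
  (forall s, s \in `[0, 1] -> D (segment_pt y x s)) ->
  has_rderiv `[0, 1] (fun s => f (segment_pt y x s) i j)
    (fun s => fderiv D f (segment_pt y x s) (x - y) i j).
Proof.
move=> [df _] segD t t01.
exact (fderiv_segment (i := i) (j := j) segD (fderivP (df _ (segD _ t01)))).
Qed.

(** Precomposing the derivative on a product with these embeddings gives the
    partial derivatives. *)
Definition inl0 (U V : lmodType R) (u : U) : U * V := (u, 0).
Definition inr0 (U V : lmodType R) (v : V) : U * V := (0, v).

Lemma inl0_is_linear (U V : lmodType R) : linear (@inl0 U V).
Proof. by move=> a u v; apply/pair_eqP; rewrite /= scaler0 addr0 !eqxx. Qed.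
HB.instance Definition _ (U V : lmodType R) :=
  GRing.isLinear.Build R U (U * V)%type *:%R (@inl0 U V) (@inl0_is_linear U V).

Lemma inr0_is_linear (U V : lmodType R) : linear (@inr0 U V).
Proof. by move=> a u v; apply/pair_eqP; rewrite /= scaler0 addr0 !eqxx. Qed.
HB.instance Definition _ (U V : lmodType R) :=
  GRing.isLinear.Build R V (U * V)%type *:%R (@inr0 U V) (@inr0_is_linear U V).

Lemma is_fderiv_fst (U V W : normedModType R) (D1 : set U) (D2 : set V)
    (f : U * V -> W) u v (L : {linear (U * V)%type -> W}) : D2 v ->
  is_fderiv (D1 `*` D2) f (u, v) L ->
  is_fderiv D1 (fun z => f (z, v)) u (L \o @inl0 U V).
Proof.
move=> D2v [Lc Lf]; split.
  move=> z; apply: (@continuous_comp _ _ _ (@inl0 U V) L); last exact: Lc.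
  by apply: cvg_pair; [exact: cvg_id|exact: cvg_cst].
move=> e /Lf; rewrite !near_withinE => H.
have : (fun z => (z, v)) @ u --> (u, v).
  by apply: cvg_pair; [exact: cvg_id|exact: cvg_cst].
move=> /(_ _ H); rewrite /= !near_simpl; apply: filterS => z zH D1z.
have /= := zH (conj D1z D2v).
have -> : (z, v) - (u, v) = inl0 V (z - u) by rewrite /inl0 -(subrr v).
by rewrite [X in _ <= _ * X]prod_normE/= normr0 max_l.
Qed.

Lemma is_fderiv_snd (U V W : normedModType R) (D1 : set U) (D2 : set V)
    (f : U * V -> W) u v (L : {linear (U * V)%type -> W}) : D1 u ->
  is_fderiv (D1 `*` D2) f (u, v) L ->
  is_fderiv D2 (fun z => f (u, z)) v (L \o @inr0 U V).
Proof.
move=> D1u [Lc Lf]; split.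
  move=> z; apply: (@continuous_comp _ _ _ (@inr0 U V) L); last exact: Lc.
  by apply: cvg_pair; [exact: cvg_cst|exact: cvg_id].
move=> e /Lf; rewrite !near_withinE => H.
have : (fun z => (u, z)) @ v --> (u, v).
  by apply: cvg_pair; [exact: cvg_cst|exact: cvg_id].
move=> /(_ _ H); rewrite /= !near_simpl; apply: filterS => z zH D2z.
have /= := zH (conj D1u D2z).
have -> : (u, z) - (u, v) = inr0 U (z - v) by rewrite /inr0 -(subrr u).
by rewrite [X in _ <= _ * X]prod_normE/= normr0 max_r.
Qed.

End RelativeDerivatives.

(** * Joint continuity and Lipschitz bounds *)

Section CompactEstimates.
Variable R : realType.

(** A linear coordinate system of the tangent space [V], bounded by the norm:
    what turns the directional continuity in [C1_on] into joint continuity of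
    the derivative in the base point and the direction. *)
Definition framed (U : normedModType R) (V : set U) :=
  exists (I : finType) (b : I -> U) (c : I -> U -> R),
  [/\ forall k, V (b k), forall k, continuous (c k),
      forall k v, `|c k v| <= `|v| &
      forall v, V v -> v = \sum_k c k v *: b k].

(** The frame is the standard basis projected along constants; a vector of mass
    zero is its own projection, so its coordinates are still its entries. *)
Lemma framed_tangent0 n : @framed 'rV[R]_n tangent0.
Proof.
exists 'I_n, (fun k => \row_i ((i == k)%:R - n%:R^-1)),
  (fun k (v : 'rV[R]_n) => v 0 k).
have [->|n0] := eqVneq n 0%N.
  split=> [[]|k|k v|v _] //; [exact: coord_continuous|exact: ler_mx_entry|].
  by apply/rowP => -[].
have nR : n%:R != 0 :> R by rewrite pnatr_eq0.
split=> [k|k|k v|v v0]; [|exact: coord_continuous|exact: ler_mx_entry|].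
  rewrite /tangent0/= (eq_bigr (fun i => (i == k)%:R - n%:R^-1)); last first.
    by move=> i _; rewrite mxE.
  have nVn : n%:R^-1 *+ n = 1 :> R by rewrite -[LHS]mulr_natl mulfV.
  rewrite sumrB sumr_const card_ord nVn.
  rewrite (bigD1 k)//= eqxx big1 ?addr0 ?subrr// => i /negPf->.
  by [].
apply/rowP => i; rewrite summxE.
rewrite (eq_bigr (fun k => (i == k)%:R * v 0 k - n%:R^-1 * v 0 k)); last first.
  by move=> k _; rewrite !mxE; ring.
rewrite sumrB -mulr_sumr v0 mulr0 subr0 (bigD1 i)//= eqxx mul1r big1 ?addr0//.
by move=> k; rewrite eq_sym => /negPf->; rewrite mul0r.
Qed.

(** Same device, with the projection antisymmetrizing and masking the edges. *)
Lemma framed_skewE n (G : wgraph R n) : framed (skewE G).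
Proof.
pose b (k : 'I_n * 'I_n) : 'M[R]_n := \matrix_(i, j)
  (2^-1 * (edge G i j)%:R * (((i, j) == k)%:R - ((j, i) == k)%:R)).
exists ('I_n * 'I_n)%type, b, (fun k (r : 'M[R]_n) => r k.1 k.2).
split=> [k|k|k v|v [vN v0]].
- split=> [i j|i j /negPf nij]; rewrite !mxE; first by rewrite edge_sym; ring.
  by rewrite nij mulr0 mul0r.
- exact: coord_continuous.
- exact: ler_mx_entry.
apply/matrixP => i j; rewrite summxE.
rewrite (eq_bigr (fun k => 2^-1 * (edge G i j)%:R *
   (((i, j) == k)%:R * v k.1 k.2 - ((j, i) == k)%:R * v k.1 k.2))); last first.
  by move=> k _; rewrite !mxE; ring.
have sumE i' j' : \sum_k (((i', j') == k)%:R * v k.1 k.2) = v i' j'.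
  rewrite (bigD1 (i', j'))//= eqxx mul1r big1 ?addr0// => k.
  by rewrite eq_sym => /negPf->; rewrite mul0r.
rewrite -mulr_sumr sumrB !sumE (vN i j) opprK.
have [ij|nij] := boolP (edge G i j); first by rewrite mulr1; field.
by rewrite v0// mulr0 mul0r.
Qed.

Lemma framed_setX (U1 U2 : normedModType R) (V1 : set U1) (V2 : set U2) :
  V1 0 -> V2 0 -> framed V1 -> framed V2 -> framed (V1 `*` V2).
Proof.
move=> V10 V20 [I1 [b1 [c1 [Vb1 cc1 le1 sp1]]]]
  [I2 [b2 [c2 [Vb2 cc2 le2 sp2]]]].
exists (I1 + I2)%type,
  (fun k => match k with inl k => inl0 U2 (b1 k) | inr k => inr0 U1 (b2 k) end),
  (fun k v => match k with inl k => c1 k v.1 | inr k => c2 k v.2 end).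
split=> [[k|k]|[k|k]|[k|k] v|v [Vv1 Vv2]].
- by split=> //; exact: Vb1.
- by split=> //; exact: Vb2.
- by move=> v; apply: continuous_comp; [exact: cvg_fst|exact: cc1].
- by move=> v; apply: continuous_comp; [exact: cvg_snd|exact: cc2].
- by apply: le_trans (le1 _ _) _; rewrite [leRHS]prod_normE le_max lexx.
- by apply: le_trans (le2 _ _) _; rewrite [leRHS]prod_normE le_max lexx orbT.
rewrite big_sumType/=.
rewrite (eq_bigr (fun k => inl0 U2 (c1 k v.1 *: b1 k))); last first.
  by move=> k _; rewrite linearZ.
rewrite [X in _ + X](eq_bigr (fun k => inr0 U1 (c2 k v.2 *: b2 k))); last first.
  by move=> k _; rewrite linearZ.
rewrite -!linear_sum -(sp1 _ Vv1) -(sp2 _ Vv2).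
by apply/pair_eqP; rewrite /= addr0 add0r !eqxx.
Qed.

Lemma fderiv_continuous (U W : normedModType R) (D V : set U) (f : U -> W) :
  C1_on D V f -> framed V ->
  {within D `*` V, continuous (fun z => fderiv D f z.1 z.2)}.
Proof.
move=> [_ fc] [I [b [c [Vb cc _ sp]]]].
apply/subspace_continuousP => -[x v] [/= Dx Vv].
have fE z w : V w -> fderiv D f z w = \sum_k c k w *: fderiv D f z (b k).
  by move=> Vw; rewrite {1}(sp w Vw) linear_sum; apply: eq_bigr => k _;
    rewrite linearZ.
have : \sum_k c k z.2 *: fderiv D f z.1 (b k)
    @[z --> within (D `*` V) (nbhs (x, v))] --> fderiv D f x v.
  rewrite fE//; apply: cvg_big => [|k _]; first exact: add_continuous.
  apply: cvgZ.
    apply: cvg_within_filter; apply: (@cvg_comp _ _ _ snd (c k) _ (nbhs v)).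
      exact: cvg_snd.
    exact: cc.
  have /subspace_continuousP/(_ x Dx) := fc _ (Vb k).
  apply: cvg_comp => P; rewrite /within/= => DP.
  have H : \forall z \near (x, v), D z.1 -> P z.1 by exact: cvg_fst DP.
  by move: H; apply: filterS => z zP [Dz _]; exact: zP.
apply: cvg_trans; apply: near_eq_cvg; near=> z.
have [_ Vz] : (D `*` V) z by near: z; exact: withinT.
by rewrite /=; exact/esym/fE.
Unshelve. all: by end_near. Qed.

Lemma compact_normbound (U W : normedModType R) (K : set U) (f : U -> W) :
  compact K -> {within K, continuous f} ->
  exists2 M : R, 0 <= M & forall x, K x -> `|f x| <= M.
Proof.
move=> cK fc; have /compact_bounded[M [Mr MP]] := continuous_compact fc cK.
exists (`|M| + 1) => [|x Kx]; first by rewrite addr_ge0.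
by apply: (MP (`|M| + 1)); [rewrite ltr_pwDr// ler_norm|exists x].
Qed.

(** Mean value inequality along segments, with the derivative bounded on the
    compact set through its finitely many frame directions. *)
Lemma C1_lipschitz (U : normedModType R) m n (D V K : set U)
    (f : U -> 'M[R]_(m, n)) :
  C1_on D V f -> framed V -> K `<=` D -> compact K -> convex_set K ->
  (forall x y, K x -> K y -> V (x - y)) ->
  exists2 L : R, 0 <= L & forall x y, K x -> K y ->
    `|f x - f y| <= L * `|x - y|.
Proof.
move=> fC1 [I [b [c [Vb cc cle sp]]]] KD cK convK KV.
have /choice[M MP] : forall k, exists M : R, 0 <= M /\
    forall x, K x -> `|fderiv D f x (b k)| <= M.
  move=> k; have [M M0 MP] := compact_normbound cK
    (continuous_subspaceW KD (fC1.2 _ (Vb k))); by exists M.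
have L0 : 0 <= \sum_k M k by apply: sumr_ge0 => k _; have [] := MP k.
exists (\sum_k M k) => // x y Kx Ky.
have dle z : K z -> `|fderiv D f z (x - y)| <= (\sum_k M k) * `|x - y|.
  move=> Kz; rewrite {1}(sp _ (KV _ _ Kx Ky)) linear_sum mulr_suml.
  apply: (le_trans (ler_norm_sum _ _ _)); apply: ler_sum => k _.
  by rewrite linearZ normrZ mulrC ler_pM//; have [] := MP k; move=> _; apply.
have segK s : s \in `[0, 1] -> K (segment_pt y x s) by exact: convK.
have segD s : s \in `[0, 1] -> D (segment_pt y x s) by move=> /segK/KD.
apply: mx_norm_le => [|i j]; first by rewrite mulr_ge0.
have df := has_rderiv_segment (i := i) (j := j) fC1 segD.
have ij s : s \in `[0, 1] ->
    `|fderiv D f (segment_pt y x s) (x - y) i j| <= (\sum_k M k) * `|x - y|.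
  by move=> s01; apply: le_trans (dle _ (segK _ s01)); exact: ler_mx_entry.
set M1 := _ * _ in ij *; set F := fun s => f (segment_pt y x s) i j.
have F0 : F 0 = f y i j by rewrite /F segment_pt0.
have F1 : F 1 = f x i j by rewrite /F segment_pt1.
have up : F 1 - F 0 <= M1 * (1 - 0).
  apply: has_rderiv_le df _ => // t t01.
  by apply: le_trans (ij t t01); exact: ler_norm.
have lo : (0 - F 1) - (0 - F 0) <= M1 * (1 - 0).
  apply: has_rderiv_le (has_rderivB (has_rderiv_cst 0) df) _ => // t t01.
  by rewrite sub0r; apply: le_trans (ij t t01); rewrite -normrN ler_norm.
by rewrite !mxE -F0 -F1 ler_norml; lra.
Qed.

End CompactEstimates.

(** * Compact convex parts of the phase space *)

Section CompactSets.
Variable R : realType.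

Lemma closed_forall (U : topologicalType) (J : Type) (P : J -> set U) :
  (forall i, closed (P i)) -> closed [set x | forall i, P i x].
Proof.
move=> Pc; rewrite (_ : mkset _ = \bigcap_i P i); first exact: closed_bigI.
by apply/seteqP; split=> x Px;
  [move=> i _; exact: Px|move=> i; exact: (Px i I)].
Qed.

Lemma closed_ge_fun (U : topologicalType) (f : U -> R) c :
  continuous f -> closed [set x | c <= f x].
Proof.
move=> fc; apply: (@preimage_closed _ _ f [set y | c <= y]);
  last exact: closed_ge.
by move=> x _; exact: fc.
Qed.

Lemma closed_le_fun (U : topologicalType) (f : U -> R) c :
  continuous f -> closed [set x | f x <= c].
Proof.
move=> fc; apply: (@preimage_closed _ _ f [set y | y <= c]);
  last exact: closed_le.
by move=> x _; exact: fc.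
Qed.

Lemma closed_eq_fun (U : topologicalType) (f : U -> R) c :
  continuous f -> closed [set x | f x = c].
Proof.
move=> fc; apply: (@preimage_closed _ _ f [set c]); last exact: closed_eq.
by move=> x _; exact: fc.
Qed.

Lemma continuous_rowsum n : continuous (fun u : 'rV[R]_n => \sum_i u 0 i).
Proof.
move=> u; apply: (@cvg_big _ _ _ _ _ add_continuous _ (nbhs u)) => i _.
exact: coord_continuous.
Qed.

Lemma compact_mx_ball m n (M : R) : compact [set p : 'M[R]_(m, n) | `|p| <= M].
Proof.
have vc : continuous (@vec_mx R m n).
  move=> u; apply/(@cvgrPdist_le _ _ _ (nbhs u)) => e e0.
  near=> v; have uv : `|u - v| <= e.
    by near: v; apply: cvgr_dist_le => //; exact: cvg_id.
  rewrite -linearB/=; apply: mx_norm_le => [|i j]; first exact: ltW.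
  apply: le_trans uv; have := ler_mx_entry (u - v) 0 (mxvec_index i j).
  by rewrite !mxE.
have : compact [set u : 'rV[R]_(m * n) | `|u| <= M].
  apply: bounded_closed_compact.
    exists M; split=> [|r Mr u /= uM]; first exact: num_real.
    by apply: le_trans uM _; exact: ltW.
  by apply: closed_le_fun; exact: norm_continuous.
move/(continuous_compact (continuous_subspaceT vc)) => vcpt.
apply: (subclosed_compact _ vcpt).
  by apply: closed_le_fun; exact: norm_continuous.
move=> p /= pM; exists (mxvec p); last exact: mxvecK.
apply: mx_norm_le => [|i j]; first by apply: le_trans pM.
case/mxvec_indexP: j => i' j'; rewrite ord1 mxvecE.
by apply: le_trans pM; exact: ler_mx_entry.
Unshelve. all: by end_near. Qed.

Lemma closed_skewE n (G : wgraph R n) : closed (skewE G).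
Proof.
apply: closedI.
  apply: closed_forall => i; apply: closed_forall => j.
  rewrite [X in closed X](_ : _ = [set p : 'M[R]_n | p j i + p i j = 0]);
    last first.
    apply/seteqP; split=> p /=; first by move=> ->; rewrite addNr.
    by move/eqP; rewrite addr_eq0 => /eqP.
  apply: closed_eq_fun => p.
  by apply: (@cvgD _ _ _ (nbhs p)); exact: coord_continuous.
apply: closed_forall => i; apply: closed_forall => j.
apply: closed_forall => _; apply: closed_eq_fun; exact: coord_continuous.
Qed.

Lemma closed_simplex_eps n (e : R) : closed (@simplex_eps R n e).
Proof.
apply: closedI; first apply: closedI.
- apply: closed_forall => i.
  rewrite [X in closed X](_ :
    _ = [set u : 'rV[R]_n | 0 <= u 0 i] `&` [set u | u 0 i <= 1]).
    by apply: closedI; [apply: closed_ge_fun|apply: closed_le_fun];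
      exact: coord_continuous.
  by apply/seteqP; split=> u /= => [/andP[]//|[-> ->]].
- by apply: closed_eq_fun; exact: continuous_rowsum.
- by apply: closed_forall => i; apply: closed_ge_fun; exact: coord_continuous.
Qed.

Lemma simplex_norm n (u : 'rV[R]_n) : simplex u -> `|u| <= 1.
Proof.
by move=> [u01 _]; apply: rV_norm_le => // i; have /andP[u0 u1] := u01 i;
  rewrite ger0_norm.
Qed.

Lemma compact_simplex_eps n (e : R) : compact (@simplex_eps R n e).
Proof.
apply: bounded_closed_compact; last exact: closed_simplex_eps.
exists 1; split=> // r r1 u [/simplex_norm u1 _]; apply: le_trans u1 _;
  exact: ltW.
Qed.

Lemma simplexE n : simplex = @simplex_eps R n 0.
Proof.
by apply/seteqP; split=> u;
  [move=> us; split=> // i; have /andP[] := us.1 i|case].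
Qed.

Lemma convex_simplex_eps n (e : R) : convex_set (@simplex_eps R n e).
Proof.
move=> x y s [[x01 x1] xe] [[y01 y1] ye]; rewrite in_itv/= => /andP[s0 s1].
have E i : segment_pt y x s 0 i = (1 - s) * y 0 i + s * x 0 i.
  by rewrite !mxE; ring.
have s1' : 0 <= 1 - s by rewrite subr_ge0.
split; first split=> [i|].
- have /andP[? ?] := x01 i; have /andP[? ?] := y01 i.
  by rewrite E; apply/andP; split; nra.
- rewrite (eq_bigr (fun i => (1 - s) * y 0 i + s * x 0 i)) => [|i _];
  last exact: E.
  by rewrite big_split/= -!mulr_sumr x1 y1; ring.
- by move=> i; rewrite E; have := xe i; have := ye i; nra.
Qed.

Lemma simplex_int_eps n (e : R) : 0 < e -> @simplex_eps R n e `<=` simplex_int.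
Proof. by move=> e0 u [us ue]; split=> // i; exact: lt_le_trans (ue i). Qed.

Lemma simplex_int_min n (u : 'rV[R]_n) : simplex_int u ->
  exists2 e : R, 0 < e & simplex_eps e u.
Proof.
move=> [us u0]; exists (\big[Num.min/1]_i u 0 i).
  by apply/bigmin_gtP; split.
by split=> // i; exact: bigmin_le_cond.
Qed.

Lemma convex_simplex_int n : convex_set (@simplex_int R n).
Proof.
move=> x y s /simplex_int_min[e e0 xe] /simplex_int_min[e' e0' ye] s01.
have m0 : 0 < Num.min e e' by rewrite lt_min e0.
apply: (simplex_int_eps m0); apply: convex_simplex_eps => //.
  by case: xe => xs xe; split=> // i; rewrite ge_min xe.
by case: ye => ys ye; split=> // i; rewrite ge_min ye orbT.
Qed.

Lemma simplexB n (x y : 'rV[R]_n) : simplex x -> simplex y -> tangent0 (x - y).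
Proof.
move=> [_ x1] [_ y1]; rewrite /tangent0/=.
rewrite (eq_bigr (fun i => x 0 i - y 0 i)) => [|i _]; last by rewrite !mxE.
by rewrite sumrB x1 y1 subrr.
Qed.

(** Every direction of total mass zero is tangent to the open simplex, so the
    derivative in the density is unique along it. *)
Lemma simplex_int_shift n (u v : 'rV[R]_n) : simplex_int u -> tangent0 v ->
  exists2 r : R, 0 < r & simplex_int (u + r *: v).
Proof.
move=> /simplex_int_min[e e0 [[u01 u1] ue]] v0.
have v1 : 0 < 2 * (`|v| + 1) by rewrite mulr_gt0// ltr_wpDl.
pose r := e / (2 * (`|v| + 1)); have r0 : 0 < r by rewrite divr_gt0.
have rv i : `|r * v 0 i| <= e / 2.
  have rE : r * (2 * (`|v| + 1)) = e by rewrite divfK// gt_eqF.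
  have : r * `|v 0 i| <= r * `|v| by rewrite ler_pM2l// ler_mx_entry.
  by rewrite normrM gtr0_norm//; lra.
have pos i : 0 < (u + r *: v) 0 i.
  by rewrite !mxE; have := rv i; rewrite ler_norml => /andP[]; have := ue i;
    lra.
have sum1 : \sum_i (u + r *: v) 0 i = 1.
  rewrite (eq_bigr (fun i => u 0 i + r * v 0 i)) => [|i _];
    last by rewrite !mxE.
  by rewrite big_split/= -mulr_sumr v0 mulr0 addr0.
exists r => //; split=> //; split=> // i;
  rewrite ltW//= -sum1 (bigD1 i)//= lerDl.
by apply: sumr_ge0 => j _; exact: ltW.
Qed.

Lemma convex_skewE_ball n (G : wgraph R n) M :
  convex_set [set p | skewE G p /\ `|p| <= M].
Proof.
move=> x y s [[xN x0] xM] [[yN y0] yM]; rewrite in_itv/= => /andP[s0 s1].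
split; first split=> [i j|i j nij].
- by rewrite !mxE xN yN; ring.
- by rewrite !mxE x0// y0// subrr mulr0 addr0.
have -> : segment_pt y x s = (1 - s) *: y + s *: x.
  by apply/matrixP => i j; rewrite !mxE; ring.
apply: le_trans (ler_normD _ _) _; rewrite !normrZ !ger0_norm ?subr_ge0//.
nra.
Qed.

Lemma compact_skewE_ball n (G : wgraph R n) M :
  compact [set p | skewE G p /\ `|p| <= M].
Proof.
apply: (subclosed_compact _ (compact_mx_ball (M := M))) => [|p []//].
apply: closedI; first exact: closed_skewE.
by apply: closed_le_fun; exact: norm_continuous.
Qed.

Definition phase_box n (G : wgraph R n) (delta M : R) :
  set ('rV[R]_n * 'M[R]_n) :=
  simplex_eps delta `*` [set p | skewE G p /\ `|p| <= M].

Lemma compact_phase_box n (G : wgraph R n) delta M :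
  compact (phase_box G delta M).
Proof.
exact: compact_setX (@compact_simplex_eps _ _) (@compact_skewE_ball _ _ _).
Qed.

Lemma convex_phase_box n (G : wgraph R n) delta M :
  convex_set (phase_box G delta M).
Proof.
move=> x y s [x1 x2] [y1 y2] s01; split.
  exact: (convex_simplex_eps x1 y1 s01).
exact: (convex_skewE_ball x2 y2 s01).
Qed.

Lemma phase_box_phase n (G : wgraph R n) delta M : 0 < delta ->
  phase_box G delta M `<=` phase G.
Proof. by move=> d0 x [x1 [x2 _]]; split=> //; exact: simplex_int_eps x1. Qed.

Lemma phase_tangentB n (G : wgraph R n) x y : phase G x -> phase G y ->
  phase_tangent G (x - y).
Proof.
move=> [[x1 _] x2] [[y1 _] y2]; split; first exact: simplexB.
exact: skewEB.
Qed.

Lemma framed_phase_tangent n (G : wgraph R n) : framed (phase_tangent G).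
Proof.
apply: framed_setX; [| |exact: framed_tangent0|exact: framed_skewE].
  by rewrite /tangent0/= big1// => i _; rewrite mxE.
by split=> [i j|i j _]; rewrite !mxE ?oppr0.
Qed.

Lemma C1_lipschitz_box n (G : wgraph R n) delta M m1 n1
    (f : 'rV[R]_n * 'M[R]_n -> 'M[R]_(m1, n1)) :
  0 < delta -> C1_on (phase G) (phase_tangent G) f ->
  exists2 L : R, 0 <= L & forall x y, phase_box G delta M x ->
    phase_box G delta M y -> `|f x - f y| <= L * `|x - y|.
Proof.
move=> d0 fC1; apply: (C1_lipschitz fC1 (framed_phase_tangent G)).
- exact: phase_box_phase.
- exact: compact_phase_box.
- exact: convex_phase_box.
- by move=> x y /(phase_box_phase d0) px /(phase_box_phase d0);
  exact: phase_tangentB.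
Qed.

Lemma compact_tangent_sphere n (G : wgraph R n) :
  compact (phase_tangent G `&` [set v | `|v| = 1]).
Proof.
have ball2 := compact_setX (@compact_mx_ball 1 n 1) (@compact_mx_ball n n 1).
apply: (subclosed_compact _ ball2) => [|v [_ /= v1]].
  apply: closedI; last by apply: closed_eq_fun; exact: norm_continuous.
  apply: closedI.
    apply: (@preimage_closed _ _ fst tangent0) => [z _|]; first exact: cvg_fst.
    by apply: closed_eq_fun; exact: continuous_rowsum.
  apply: (@preimage_closed _ _ snd (skewE G)) => [z _|]; first exact: cvg_snd.
  exact: closed_skewE.
by split=> /=; rewrite -v1 [leRHS]prod_normE le_max lexx ?orbT.
Qed.

End CompactSets.

(** * Uniform monotonicity *)

Section Coercivity.
Variables (R : realType) (d : nat) (G : wgraph R d).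

(** Strict monotonicity is assumed on the partial derivatives, continuity on the
    derivative in the pair; on tangent directions the former add up to the
    latter, because relative derivatives are unique there. *)
Lemma partials_sum m n (f : 'rV[R]_d -> 'M[R]_d -> 'M[R]_(m, n)) rho p eta r :
  (exists L, is_fderiv (phase G) (fun x => f x.1 x.2) (rho, p) L) ->
  simplex_int rho -> skewE G p -> tangent0 eta -> skewE G r ->
  fderiv simplex_int (fun s => f s p) rho eta + fderiv (skewE G) (f rho) p r
  = fderiv (phase G) (fun x => f x.1 x.2) (rho, p) (eta, r).
Proof.
move=> /fderivP fP rhos ps eta0 rs.
set L := fderiv (phase G) _ _ in fP *.
have f1 := is_fderiv_fst ps fP; have f2 := is_fderiv_snd rhos fP.
have -> : (eta, r) = inl0 _ eta + inr0 _ r.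
  by apply/pair_eqP; rewrite /= addr0 add0r !eqxx.
rewrite linearD; congr (_ + _).
  have [a a0 as_] := simplex_int_shift rhos eta0.
  have seg s : s \in `[0, 1] -> simplex_int (segment_pt rho (rho + a *: eta) s).
    by move=> s01; exact: convex_simplex_int.
  have := fderiv_unique seg (fderivP (ex_intro _ _ f1)) f1.
  rewrite addrAC subrr add0r !linearZ => /(scalerI _); apply.
  by rewrite gt_eqF.
have seg s : s \in `[0, 1] -> skewE G (segment_pt p (p + r) s).
  move=> _; rewrite /segment_pt addrAC subrr add0r.
  case: ps rs => [pN p0] [rN r0]; split=> [i j|i j nij]; rewrite !mxE.
    by rewrite pN rN; ring.
  by rewrite p0// r0// mulr0 addr0.
have := fderiv_unique seg (fderivP (ex_intro _ _ f2)) f2.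
by rewrite addrAC subrr add0r.
Qed.

Variables (H : 'rV[R]_d -> 'M[R]_d -> 'rV[R]_d).
Variables (B : 'rV[R]_d -> 'M[R]_d -> 'M[R]_d).
Variables (g : 'rV[R]_d -> 'rV[R]_d).
Hypotheses (hA : assumptionA G H B g) (hB : assumptionB G H B g).

Let uH (x : 'rV[R]_d * 'M[R]_d) := H x.1 x.2.
Let uB (x : 'rV[R]_d * 'M[R]_d) := B x.1 x.2.

(** The quadratic form of strict monotonicity, through the derivatives in the
    pair (density, momentum). *)
Definition mono_form x (v : 'rV[R]_d * 'M[R]_d) : R :=
  dotv (fderiv (phase G) uH x v) v.1 - dotE G (fderiv (phase G) uB x v) v.2.

Lemma mono_form_lt0 x v : phase G x -> phase_tangent G v -> v != 0 ->
  mono_form x v < 0.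
Proof.
case: x v => [rho p] [eta r] [/= rhos ps] [/= eta0 rs] vn0.
have := B_strict hB rhos ps eta0 rs vn0.
rewrite /DrhoH /DpH /DrhoB /DpB.
have HL := (A_H_C1 hA).1 (rho, p) (conj rhos ps).
have BL := (A_B_C1 hA).1 (rho, p) (conj rhos ps).
by rewrite (partials_sum HL)// (partials_sum BL).
Qed.

Lemma mono_formZ x a v : mono_form x (a *: v) = a ^+ 2 * mono_form x v.
Proof.
rewrite /mono_form [X in dotv X _]linearZ [X in dotE _ X _]linearZ /=.
by rewrite dotvZl dotvZr dotEZl dotEZr; ring.
Qed.

Lemma mono_form0 x : mono_form x 0 = 0.
Proof.
by rewrite -[X in mono_form _ X](scale0r (0 : 'rV[R]_d * 'M[R]_d)) mono_formZ
  expr0n mul0r.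
Qed.

Lemma mono_form_continuous :
  {within phase G `*` phase_tangent G, continuous (fun z => mono_form z.1 z.2)}.
Proof.
have fr := framed_phase_tangent G.
have /subspace_continuousP Hc := fderiv_continuous (A_H_C1 hA) fr.
have /subspace_continuousP Bc := fderiv_continuous (A_B_C1 hA) fr.
apply/subspace_continuousP => z zP.
have entry m n
  (F : ('rV[R]_d * 'M[R]_d) * ('rV[R]_d * 'M[R]_d) -> 'M[R]_(m, n)) i j :
    F @ within (phase G `*` phase_tangent G) (nbhs z) --> F z ->
    F x i j @[x --> within (phase G `*` phase_tangent G) (nbhs z)] --> F z i j.
  by move=> Fz; exact: (cvg_comp _ _ Fz (@coord_continuous R m n i j _)).
have c1 : (fun w : ('rV[R]_d * 'M[R]_d) * ('rV[R]_d * 'M[R]_d) => w.2.1)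
    @ within (phase G `*` phase_tangent G) (nbhs z) --> z.2.1.
  by apply: cvg_within_filter; apply: (cvg_comp snd fst);
    [exact: cvg_snd|exact: cvg_fst].
have c2 : (fun w : ('rV[R]_d * 'M[R]_d) * ('rV[R]_d * 'M[R]_d) => w.2.2)
    @ within (phase G `*` phase_tangent G) (nbhs z) --> z.2.2.
  by apply: cvg_within_filter; apply: (cvg_comp snd snd);
    [exact: cvg_snd|exact: cvg_snd].
apply: cvgB.
  apply: cvg_big => [|i _]; first exact: add_continuous.
  by apply: cvgM;
    [exact: (entry _ _ _ _ _ (Hc z zP))|exact: (entry _ _ _ _ _ c1)].
apply: cvgM; first exact: cvg_cst.
apply: cvg_big => [|i _]; first exact: add_continuous.
by apply: cvgM;
  [exact: (entry _ _ _ _ _ (Bc z zP))|exact: (entry _ _ _ _ _ c2)].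
Qed.

(** Strict negativity becomes uniform on a compact set of base points because
    the unit sphere of tangent directions is compact as well. *)
Lemma mono_form_coercive delta M : 0 < delta ->
  exists2 c : R, 0 < c & forall x v, phase_box G delta M x ->
    phase_tangent G v ->
    mono_form x v <= - c * `|v| ^+ 2.
Proof.
move=> delta0; pose S := phase_tangent G `&` [set v | `|v| = 1].
pose KS := phase_box G delta M `*` S.
have normalize v : phase_tangent G v -> v != 0 -> S (`|v|^-1 *: v).
  move=> [v1 [v2N v20]] v0; split.
    split; [|split] => /=.
    - rewrite /tangent0/=; under eq_bigr do rewrite mxE.
      by rewrite -mulr_sumr v1 mulr0.
    - by move=> i j; rewrite !mxE v2N mulrN.
    - by move=> i j nij; rewrite !mxE v20// mulr0.
  by rewrite /= normrZ normfV normr_id mulVf// normr_eq0.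
have [KS0|KSn0] := pselect (KS !=set0); last first.
  exists 1 => // x v Kx Vv; have [->|v0] := eqVneq v 0.
    by rewrite mono_form0 normr0 expr0n mulr0.
  exfalso; apply: KSn0; exists (x, `|v|^-1 *: v); split=> //; exact: normalize.
have KSc : compact KS.
  by apply: compact_setX;
    [exact: compact_phase_box|exact: compact_tangent_sphere].
have KSs : KS `<=` phase G `*` phase_tangent G.
  by move=> z [/(phase_box_phase delta0) z1 [z2 _]].
have [z zKS zmax] := compact_EVT_max KS0 KSc
  (continuous_subspaceW KSs mono_form_continuous).
move: zKS; rewrite inE => zKS.
exists (- mono_form z.1 z.2).
  have [z1 z2] := KSs _ zKS.
  rewrite oppr_gt0; apply: mono_form_lt0 => //.
  by apply/eqP => z20; case: zKS => _ [_ /=]; rewrite z20 normr0 => /esym/eqP;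
    rewrite oner_eq0.
move=> x v Kx Vv; rewrite opprK; have [->|v0] := eqVneq v 0.
  by rewrite mono_form0 normr0 expr0n mulr0.
have vn : `|v| != 0 by rewrite normr_eq0.
have vE : v = `|v| *: (`|v|^-1 *: v) by rewrite scalerA mulfV// scale1r.
rewrite {1}vE mono_formZ mulrC ler_wpM2r ?sqr_ge0//.
by apply: (zmax (x, `|v|^-1 *: v)); rewrite inE; split=> //; exact: normalize.
Qed.

(** Integrate the coercive form along the segment from [y] to [x], which stays
    in the box. *)
Lemma HB_monotone delta M : 0 < delta ->
  exists2 c : R, 0 < c & forall x y, phase_box G delta M x ->
    phase_box G delta M y ->
    dotv (uH x - uH y) (x.1 - y.1) - dotE G (uB x - uB y) (x.2 - y.2)
    <= - c * `|x - y| ^+ 2.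
Proof.
move=> delta0; have [c c0 cP] := @mono_form_coercive delta M delta0.
exists c => // x y Kx Ky.
have segK s : s \in `[0, 1] -> phase_box G delta M (segment_pt y x s).
  exact: convex_phase_box.
have segD s : s \in `[0, 1] -> phase G (segment_pt y x s).
  by move=> /segK/(phase_box_phase delta0).
have Vxy : phase_tangent G (x - y).
  by apply: phase_tangentB;
    [exact: phase_box_phase Kx|exact: phase_box_phase Ky].
pose F s := dotv (uH (segment_pt y x s)) (x.1 - y.1)
  - dotE G (uB (segment_pt y x s)) (x.2 - y.2).
have dF : has_rderiv `[0, 1] F (fun s => mono_form (segment_pt y x s) (x - y)).
  have dH i := has_rderiv_segment (i := 0) (j := i) (A_H_C1 hA) segD.
  have dB i j := has_rderiv_segment (i := i) (j := j) (A_B_C1 hA) segD.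
  have sH := has_rderiv_sum (P := xpredT)
    (fun i => has_rderivZ (c := (x.1 - y.1) 0 i) (dH i)).
  have sB := has_rderiv_sum (P := fun e : 'I_d * 'I_d => edge G e.1 e.2)
    (fun e => has_rderivZ (c := (x.2 - y.2) e.1 e.2) (dB e.1 e.2)).
  have := has_rderivB sH (has_rderivZ (c := 2^-1) sB).
  by apply: has_rderiv_ext => s _; congr (_ - _ * _); apply: eq_bigr => i _;
    rewrite mulrC.
have := has_rderiv_le ler01 dF (fun t t01 => cP _ _ (segK t t01) Vxy).
by rewrite /F !segment_pt0 !segment_pt1 subr0 mulr1 dotvBl dotEBl; lra.
Qed.

End Coercivity.

(** * Flux out of a vertex of least density *)

Section Flux.
Variables (R : realType) (d : nat) (G : wgraph R d).
Variable B : 'rV[R]_d -> 'M[R]_d -> 'M[R]_d.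

(** A large density ratio makes the flux a small multiple of the density jump,
    which diffusion absorbs; a bounded ratio makes it a bounded multiple of the
    smaller density. *)
Lemma flux_local a p i j : flux_bound G B a -> skewE G p -> edge G i j ->
  exists C : R, \forall q \near p, skewE G q -> forall rho, simplex_int rho ->
    rho 0 i <= rho 0 j -> Num.sqrt (weight G i j) * `|B rho q i j| <=
      weight G i j * (rho 0 j - rho 0 i) + C * rho 0 i.
Proof.
move=> [a0 aloc _ ainf aB] ps ij.
have w0 := weight_gt0 ij; set w := weight G i j in w0 *.
set s := Num.sqrt w; have s0 : 0 < s by rewrite sqrtr_gt0.
have s2 : s * s = w by rewrite -expr2 sqr_sqrtr// ltW.
have [K pK] := ainf p ps; move=> /(_ (s / 2)) [|U0 [_ U0P]].
  by rewrite divr_gt0.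
(* For a ratio of at least 3, half the sum of the densities is at most their
   difference, so [s / 2] is what diffusion absorbs. *)
pose U := Num.max U0 3.
have U3 : 3 <= U by rewrite le_max lexx orbT.
have : compact `[1, U] by exact: segment_compact.
move/compact_near_coveringP => /(_ _ (filter_prod (nbhs p) (pinfty_nbhs R))
  (fun qC u => skewE G qC.1 -> a u qC.1 <= qC.2) _) [].
  move=> u; rewrite /= in_itv/= => /andP[u1 _].
  have u0 : 0 < u by apply: lt_le_trans u1.
  have [M [[A1 A2] [/= uA1 pA2] A12]] := aloc u p u0 ps.
  exists (A1 `&` [set x | 0 < x], [set qC | A2 qC.1 /\ M < qC.2]).
    split=> /=.
      by apply: filterI => //; exact: lt_nbhsr.
    exists (A2, [set C | M < C]); last by [].
    by split=> //=; exists M; split=> //; exact: num_real.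
  move=> [x [q C]] [/= [A1x x0] [A2q MC]] qs.
  by apply: le_trans (ltW MC); exact: (A12 (x, q) (conj A1x A2q)).
move=> [Q C0Q] [/= pQ [C0 [_ C0P]]] QP.
have cpos : 0 < s * (1 + U) by rewrite mulr_gt0//; lra.
exists (s * (1 + U) * (`|C0| + 1)).
have pKQ : nbhs p (K `&` Q) by exact: filterI.
apply: filterS pKQ => q [Kq Qq] qs rho rhos rij.
have [rhosx rho0] := rhos.
have ri0 := rho0 i; have rj0 := rho0 j.
have Bq : s * `|B rho q i j|
  <= s * ((rho 0 i + rho 0 j) * a (rho 0 j / rho 0 i) q).
  by rewrite ler_pM2l//; exact: aB.
apply: le_trans Bq _.
set u := rho 0 j / rho 0 i.
have rjE : rho 0 j = u * rho 0 i by rewrite divfK// gt_eqF.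
have u1 : 1 <= u by rewrite ler_pdivlMr// mul1r.
have u0 : 0 < u by apply: lt_le_trans u1.
have [uU|Uu] := leP u U.
  have : a u q <= `|C0| + 1.
    have /QP : (Q `*` C0Q)%classic (q, `|C0| + 1).
      by split=> //; apply: C0P; rewrite ltr_pwDr// ler_norm.
    by apply => //; rewrite /= in_itv/= u1.
  move=> au; have := a0 u q u0 qs => a00.
  have : s * ((rho 0 i + rho 0 j) * a u q)
    <= s * (((1 + U) * rho 0 i) * (`|C0| + 1)).
    rewrite ler_pM2l//; apply: ler_pM => //; first by rewrite addr_ge0// ltW.
    by rewrite rjE; nra.
  have : 0 <= w * (rho 0 j - rho 0 i) by rewrite mulr_ge0// ?subr_ge0// ltW.
  lra.
have : a u q <= s / 2.
  apply: U0P => //; apply: le_lt_trans Uu.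
  by rewrite le_max lexx.
move=> au.
have : s * ((rho 0 i + rho 0 j) * a u q) <= s * ((rho 0 i + rho 0 j) * (s / 2)).
  by rewrite ler_pM2l// ler_pM2l// addr_gt0.
have -> : s * ((rho 0 i + rho 0 j) * (s / 2)) = w * (rho 0 i + rho 0 j) / 2.
  by rewrite -s2; ring.
have : 0 <= s * (1 + U) * (`|C0| + 1) * rho 0 i.
  by apply: mulr_ge0 (ltW ri0); rewrite mulr_ge0// ltW.
have : 3 * rho 0 i <= rho 0 j by rewrite rjE ler_pM2r//; lra.
nra.
Qed.

(** Near each momentum some constant works and so does every larger one, so
    compactness yields one constant; then sum over the edges at [i]. *)
Lemma flux_compact a (P : set 'M[R]_d) : flux_bound G B a ->
  P `<=` skewE G -> compact P ->
  exists2 C : R, 0 <= C & forall rho p i, simplex_int rho -> P p ->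
    (forall j, rho 0 i <= rho 0 j) ->
    - C * rho 0 i <= (divG G (B rho p) + lapG G rho) 0 i.
Proof.
move=> aB Ps Pc.
have /choice[C CP] : forall e : 'I_d * 'I_d, exists C : R, 0 <= C /\
    (edge G e.1 e.2 -> forall p rho, P p -> simplex_int rho ->
    rho 0 e.1 <= rho 0 e.2 ->
      Num.sqrt (weight G e.1 e.2) * `|B rho p e.1 e.2| <=
      weight G e.1 e.2 * (rho 0 e.2 - rho 0 e.1) + C * rho 0 e.1).
  move=> [i j] /=; have [ij|] := boolP (edge G i j); last by exists 0.
  have Pn := (near_covering_withinP P).2 ((compact_near_coveringP P).1 Pc).
  have [] := Pn _ (pinfty_nbhs R) (fun C p => forall rho, simplex_int rho ->
    rho 0 i <= rho 0 j -> Num.sqrt (weight G i j) * `|B rho p i j| <=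
      weight G i j * (rho 0 j - rho 0 i) + C * rho 0 i) _.
    move=> p Pp; have [C CP] := flux_local aB (Ps _ Pp) ij.
    exists ([set q | skewE G q -> forall rho, simplex_int rho ->
      rho 0 i <= rho 0 j -> Num.sqrt (weight G i j) * `|B rho q i j| <=
      weight G i j * (rho 0 j - rho 0 i) + C * rho 0 i], [set C' | C < C']).
      by split=> //=; exists C; split=> //; exact: num_real.
    move=> [q C'] [/= qP CC'] Pq rho rhos rij.
    apply: le_trans (qP (Ps _ Pq) rho rhos rij) _.
    by rewrite lerD2l ler_pM2r ?ltW//; have [] := rhos.
  move=> C0 [_ C0P]; exists (`|C0| + 1); split; first by rewrite addr_ge0.
  move=> _ p rho Pp rhos rij; apply: C0P => //.
  by rewrite ltr_pwDr// ler_norm.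
exists (\sum_e C e) => [|rho p i rhos Pp rmin].
  by apply: sumr_ge0 => e _; have [] := CP e.
have [_ rho0] := rhos.
rewrite mxE lapGE mxE mulNr -[X in _ <= X + _]sumrN -big_split/= mulr_suml.
have -> : \sum_e C e * rho 0 i = \sum_k \sum_j C (k, j) * rho 0 i.
  by rewrite pair_big; apply: eq_bigr => -[].
rewrite (bigD1 i)//= [X in X + _](bigID (fun j => edge G i j))/= -addrA opprD.
rewrite -sumrN -[leRHS]addr0; apply: lerD; last first.
  rewrite oppr_le0 addr_ge0//; apply: sumr_ge0 => j _.
    by apply: mulr_ge0 (ltW (rho0 i)); have [] := CP (i, j).
  by apply: sumr_ge0 => k _; apply: mulr_ge0 (ltW (rho0 i));
    have [] := CP (j, k).
apply: ler_sum => j ij; have [_ /(_ ij p rho Pp rhos (rmin j))/=] := CP (i, j).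
have := ler_norm (B rho p i j); have := sqrtr_ge0 (weight G i j); nra.
Qed.

End Flux.

(** * A priori bounds for the scheme *)

Section APriori.
Variables (R : realType) (d : nat) (G : wgraph R d).

Definition total_weight : R := \sum_i \sum_j weight G i j.

Lemma total_weight_ge0 : 0 <= total_weight.
Proof.
by apply: sumr_ge0 => i _; apply: sumr_ge0 => j _; exact: weight_ge0.
Qed.

(** Only the distance to an upper bound of [u] counts, which is what a forward
    Gronwall estimate of that distance requires. *)
Lemma lapG_le_gap (u : 'rV[R]_d) U i : (forall j, u 0 j <= U) ->
  lapG G u 0 i <= total_weight * (U - u 0 i).
Proof.
move=> uU; rewrite lapGE /total_weight [X in _ <= X * _](bigD1 i)//= mulrDl
  mulr_suml.
rewrite [X in _ <= X + _](bigID (fun j => edge G i j))/= -addrA -[leLHS]addr0.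
have gap0 : 0 <= U - u 0 i by rewrite subr_ge0.
apply: lerD; last first.
  apply: addr_ge0; first by apply: sumr_ge0 => j _;
    rewrite mulr_ge0// weight_ge0.
  apply: mulr_ge0 => //; apply: sumr_ge0 => k _; apply: sumr_ge0 => j _.
  exact: weight_ge0.
by apply: ler_sum => j _; rewrite ler_wpM2l ?weight_ge0// lerB.
Qed.

(** An average of [u] bounded below, with every weight at least [e] and [u]
    bounded above, bounds every entry of [u] below. *)
Lemma dotv_entry_lower (u r : 'rV[R]_d) e E U : 0 < e -> 0 <= E -> 0 <= U ->
  simplex_eps e r -> (forall j, u 0 j <= U) -> - E <= dotv u r ->
  forall i, - ((E + U) / e) <= u 0 i.
Proof.
move=> e0 E0 U0 [[r01 r1] re] uU Er i.
have [ui0|ui0] := leP 0 (u 0 i).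
  by apply: le_trans ui0; rewrite oppr_le0 divr_ge0 ?addr_ge0// ltW.
have rle : \sum_(j | j != i) u 0 j * r 0 j <= U.
  apply: (@le_trans _ _ (\sum_(j | j != i) U * r 0 j)).
    by apply: ler_sum => j _; rewrite ler_wpM2r//; have /andP[] := r01 j.
  rewrite -mulr_sumr ler_piMr// -r1 [leRHS](bigD1 i)//= lerDr.
  by have /andP[] := r01 i.
move: Er; rewrite /dotv (bigD1 i)//= => Er.
have := re i; rewrite -mulNr ler_pdivrMr//; nra.
Qed.

Lemma dotv_lower (u r : 'rV[R]_d) c : simplex r -> norm_sup u <= c ->
  - c <= dotv u r.
Proof.
move=> [r01 r1] uc; rewrite -[c]mulr1 -r1 mulr_sumr -sumrN.
apply: ler_sum => i _; have /andP[r0 _] := r01 i; rewrite -mulNr ler_wpM2r//.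
have := le_trans (ler_mx_entry u 0 i) (le_trans (le_norm_sup u) uc).
by rewrite ler_norml => /andP[].
Qed.

Lemma norm_sup_entry_le (u : 'rV[R]_d) c i : norm_sup u <= c -> u 0 i <= c.
Proof.
move=> uc; apply: le_trans (ler_norm _) _.
exact: le_trans (ler_mx_entry u 0 i) (le_trans (le_norm_sup u) uc).
Qed.

Lemma ord_argmax (u : 'rV[R]_d) (i0 : 'I_d) : exists i, forall j,
  u 0 j <= u 0 i.
Proof.
exists [arg max_(i > i0) u 0 i]%O; case: arg_maxP => // i _ iP j; exact: iP.
Qed.

Lemma ord_argmin (u : 'rV[R]_d) (i0 : 'I_d) : exists i, forall j,
  u 0 i <= u 0 j.
Proof.
exists [arg min_(i < i0) u 0 i]%O; case: arg_minP => // i _ iP j; exact: iP.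
Qed.

Lemma expr_le_exp (x : R) n : 0 <= x -> (1 + x) ^+ n <= expR (n%:R * x).
Proof.
move=> x0; rewrite expRM_natl; apply: lerXn2r; rewrite ?nnegrE.
- by rewrite addr_ge0.
- exact: expR_ge0.
- exact: expR_ge1Dx.
Qed.

Variables (H : 'rV[R]_d -> 'M[R]_d -> 'rV[R]_d).
Variables (B : 'rV[R]_d -> 'M[R]_d -> 'M[R]_d).
Variables (g : 'rV[R]_d -> 'rV[R]_d).
Hypothesis hA : assumptionA G H B g.
Variables (T eps : R).
Hypotheses (hT : 0 < T) (eps0 : 0 < eps).

Section Scheme.
Variables (rho0 : 'rV[R]_d) (N : nat) (phi rho : nat -> 'rV[R]_d).
Hypotheses (hrho0 : simplex_eps eps rho0) (N0 : (0 < N)%N).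
Hypothesis sol : interior_solution G H B g T rho0 N phi rho.

Let tau := T / N%:R.

Lemma tau_gt0 : 0 < tau.
Proof. by rewrite divr_gt0// ltr0n. Qed.

Lemma natM_tau_le n : (n <= N)%N -> n%:R * tau <= T.
Proof.
move=> nN; rewrite mulrC -mulrA ger_pMr// ler_pdivrMl ?ltr0n//.
by rewrite mulr1 ler_nat.
Qed.

Lemma scheme_phi_step n : (n < N)%N ->
  phi n.+1 - phi n = tau *: (H (rho n.+1) (gradG G (phi n)) - lapG G (phi n)).
Proof.
move=> nN; rewrite -(scheme_phi sol nN) scalerA mulfV ?scale1r//.
by rewrite gt_eqF// tau_gt0.
Qed.

Lemma scheme_rho_step n : (n < N)%N ->
  rho n.+1 - rho n =
  tau *: (divG G (B (rho n.+1) (gradG G (phi n))) + lapG G (rho n.+1)).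
Proof.
move=> nN; rewrite -(scheme_rho sol nN) scalerA mulfV ?scale1r//.
by rewrite gt_eqF// tau_gt0.
Qed.

Lemma scheme_simplex_int n : (n <= N)%N -> simplex_int (rho n).
Proof. exact: scheme_interior sol n. Qed.

(** Backward maximum principle: where [phi n] is largest its Laplacian is
    nonpositive and [H] is at least [- CH]. *)
Lemma scheme_phi_upper CH Cg : 0 <= CH ->
  (forall rho p, simplex_int rho -> skewE G p ->
    forall i, H rho p 0 i >= - CH) ->
  (forall rho, simplex rho -> norm_sup (g rho) <= Cg) ->
  forall n i, (n <= N)%N -> phi n 0 i <= Cg + T * CH.
Proof.
move=> CH0 HC gC n i nN.
suff up k : (k <= N)%N -> forall i, phi (N - k)%N 0 i <= Cg + k%:R * tau * CH.
  have := up (N - n)%N (leq_subr _ _) i; rewrite subKn// => /le_trans; apply.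
  by rewrite lerD2l ler_wpM2r// natM_tau_le// leq_subr.
elim: k => [|k IH] kN j.
  rewrite subn0 !mul0r addr0 (scheme_phiN sol); apply: norm_sup_entry_le.
  by apply: gC; have [] := scheme_simplex_int (leqnn N).
have [m mP] := ord_argmax (phi (N - k.+1)%N) j.
apply: le_trans (mP j) _.
have lt : (N - k.+1 < N)%N by rewrite ltn_subrL.
have := scheme_phi_step lt; rewrite subnSK// => /rowP/(_ m).
rewrite entryB entryZ entryB => E.
have := HC _ _ (scheme_simplex_int (leq_subr k N))
  (skewE_gradG G (phi (N - k.+1)%N)) m.
have := lapG_max G mP; have := IH (ltnW kN) m.
have := tau_gt0; rewrite -natr1; nra.
Qed.

(** Coercivity is exactly the sign of the right-hand side of the duality
    identity, up to [C0]. *)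
Lemma scheme_energy C0 : 0 <= C0 ->
  (forall rho p, simplex_int rho -> skewE G p ->
      dotE G (B rho p) p >= dotv (H rho p) rho - C0) ->
  dotv (phi N) (rho N) - T * C0 <= dotv (phi 0%N) (rho 0%N).
Proof.
move=> C00 coer.
suff en n : (n <= N)%N ->
    dotv (phi n) (rho n) - n%:R * tau * C0 <= dotv (phi 0%N) (rho 0%N).
  by apply: le_trans (en N (leqnn N));
    rewrite lerD2l lerN2 ler_wpM2r// natM_tau_le.
elim: n => [|n IH] nN; first by rewrite !mul0r subr0.
have rs := scheme_simplex_int nN; have ps := skewE_gradG G (phi n).
have rE := scheme_rho_step nN; rewrite -[X in tau *: X]addr0 in rE.
have := duality_step (A_B_skew hA rs ps) (scheme_phi_step nN) rE.
have -> : dotv (phi n) 0 = 0 by rewrite -(scale0r (phi n)) dotvZr mul0r.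
have := coer _ _ rs ps; have := IH (ltnW nN); have := tau_gt0.
by rewrite -natr1; nra.
Qed.

(** Forward Gronwall for [U - phi n + 1]. The distance to the upper bound makes
    the Laplacian one-sided, and the added 1 absorbs the constant [CH]; the
    density enters only through the value at time 0. *)
Lemma scheme_phi_lower CH U A0 : 0 <= CH ->
  (forall rho p, simplex_int rho -> skewE G p ->
    forall i, H rho p 0 i >= - CH) ->
  (forall n i, (n <= N)%N -> phi n 0 i <= U) ->
  (forall i, - A0 <= phi 0%N 0 i) ->
  forall n i, (n <= N)%N ->
  U - (U + A0 + 1) * expR ((total_weight + CH) * T) <= phi n 0 i.
Proof.
move=> CH0 HC phiU phiA n i nN; set L := total_weight + CH.
have L0 : 0 <= L by rewrite addr_ge0// total_weight_ge0.
have t0 := tau_gt0.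
have UA0 : 0 <= U + A0 + 1.
  have := phiU 0%N i isT; have := phiA i; lra.
have up k : (k <= N)%N ->
  U - phi k 0 i + 1 <= (U + A0 + 1) * (1 + tau * L) ^+ k.
  elim: k => [|k IH] kN; first by rewrite expr0 mulr1; have := phiA i; lra.
  have := IH (ltnW kN); rewrite exprSr mulrA.
  set Y := (U + A0 + 1) * _ => Yk.
  have kU j : phi k 0 j <= U by apply: phiU; exact: ltnW.
  have := scheme_phi_step kN => /rowP/(_ i); rewrite entryB entryZ entryB => E.
  have := HC _ _ (scheme_simplex_int kN) (skewE_gradG G (phi k)) i.
  have gap := lapG_le_gap i kU.
  have yk : 1 <= U - phi k 0 i + 1 by rewrite lerDr subr_ge0.
  have W0 := total_weight_ge0.
  move=> Hk.
  have : U - phi k.+1 0 i + 1 <= (U - phi k 0 i + 1) * (1 + tau * L).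
    rewrite /L; set W := total_weight in W0 gap *.
    have : U - phi k.+1 0 i + 1 <= (U - phi k 0 i + 1)
        + tau * (CH + W * (U - phi k 0 i)).
      nra.
    have psi0 : 0 <= U - phi k 0 i by rewrite subr_ge0.
    have : 0 <= tau * (CH * (U - phi k 0 i) + W).
      by rewrite mulr_ge0 ?(ltW t0)// addr_ge0// mulr_ge0.
    lra.
  by move/le_trans; apply; rewrite ler_wpM2r// addr_ge0// mulr_ge0// ltW.
have := up n nN.
have : (1 + tau * L) ^+ n <= expR (L * T).
  apply: le_trans (expr_le_exp _ _) _; first by rewrite mulr_ge0// ltW.
  by rewrite ler_expR mulrA mulrC ler_wpM2l// natM_tau_le.
nra.
Qed.

(** The implicit density makes the loss at the least entry proportional to the
    new minimum, which decays at most geometrically. *)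
Lemma scheme_rho_lower C P : 0 <= C ->
  (forall rho p i, simplex_int rho -> P p ->
    (forall j, rho 0 i <= rho 0 j) ->
    - C * rho 0 i <= (divG G (B rho p) + lapG G rho) 0 i) ->
  (forall n, (n <= N)%N -> P (gradG G (phi n))) ->
  forall n i, (n <= N)%N -> eps * expR (- (C * T)) <= rho n 0 i.
Proof.
move=> C0 flux phiP n i nN; have t0 := tau_gt0.
have tC0 : 0 <= tau * C by rewrite mulr_ge0// ltW.
have up k : (k <= N)%N -> forall i, eps <= rho k 0 i * (1 + tau * C) ^+ k.
  elim: k => [|k IH] kN j.
    by rewrite expr0 mulr1 (scheme_rho0 sol); have [_] := hrho0; apply.
  have [m mP] := ord_argmin (rho k.+1) j.
  have := flux _ _ m (scheme_simplex_int kN) (phiP k (ltnW kN)) mP.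
  have := scheme_rho_step kN => /rowP/(_ m).
  rewrite entryB entryZ => E Fm.
  have k1 : rho k 0 m <= rho k.+1 0 m * (1 + tau * C) by nra.
  have X0 : 0 <= (1 + tau * C) ^+ k by rewrite exprn_ge0// addr_ge0.
  apply: le_trans (IH (ltnW kN) m) _; rewrite exprS mulrA.
  rewrite ler_wpM2r//; apply: le_trans k1 _.
  by rewrite ler_wpM2r// addr_ge0.
have [_ r0] := scheme_simplex_int nN.
have : (1 + tau * C) ^+ n <= expR (C * T).
  apply: le_trans (expr_le_exp _ _) _ => //.
  by rewrite ler_expR mulrA mulrC ler_wpM2l// natM_tau_le.
rewrite expRN -ler_pdivlMr ?invr_gt0 ?expR_gt0// invrK => X.
by apply: le_trans (up n nN i) _; rewrite ler_pM2l.
Qed.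

End Scheme.

Lemma interval_norm_le (u : 'rV[R]_d) a b : 0 <= a -> 0 <= b ->
  (forall i, - a <= u 0 i) -> (forall i, u 0 i <= b) -> `|u| <= a + b.
Proof.
move=> a0 b0 ua ub; apply: rV_norm_le => [|i]; first exact: addr_ge0.
rewrite ler_norml; have := ua i; have := ub i; lra.
Qed.

Lemma scheme_a_priori : exists delta M : R, 0 < delta /\ 0 <= M /\
  forall rho0 N, simplex_eps eps rho0 -> (0 < N)%N ->
  forall phi rho, interior_solution G H B g T rho0 N phi rho ->
  forall n, (n <= N)%N ->
    [/\ simplex_eps delta (rho n), `|phi n| <= M & `|gradG G (phi n)| <= M].
Proof.
have [C0 C00 coer] := A_coercive hA; have [CH CH0 HC] := A_H_lower hA.
have [Cg Cg0 gC] := A_g_bounded hA; have [a aB] := A_flux hA.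
pose U := Cg + T * CH; pose E := Cg + T * C0; pose A0 := (E + U) / eps.
pose M1 := (U + A0 + 1) * expR ((total_weight + CH) * T).
have U0 : 0 <= U by rewrite addr_ge0// mulr_ge0// ltW.
have E0 : 0 <= E by rewrite addr_ge0// mulr_ge0// ltW.
have A00 : 0 <= A0 by apply: divr_ge0; [exact: addr_ge0|exact: ltW].
have M10 : 0 <= M1.
  by apply: mulr_ge0; [rewrite addr_ge0// addr_ge0|exact: expR_ge0].
pose M2 := 2 * opnorm_graph G * (M1 + U).
have [C Cn0 flux] := flux_compact aB (P := [set p | skewE G p /\ `|p| <= M2])
  (fun p ps => ps.1) (@compact_skewE_ball _ _ G M2).
exists (eps * expR (- (C * T))), (Num.max (M1 + U) M2).
split; first by rewrite mulr_gt0 ?expR_gt0.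
split; first by rewrite le_max (addr_ge0 M10 U0).
move=> rho0 N hrho0 N0 phi rho sol.
have up := scheme_phi_upper N0 sol CH0 HC gC.
have low0 : forall i, - A0 <= phi 0%N 0 i.
  apply: (dotv_entry_lower eps0 E0 U0 hrho0) => [j|]; first exact: up.
  rewrite -(scheme_rho0 sol); apply: le_trans (scheme_energy N0 sol C00 coer).
  have [rNs _] := scheme_simplex_int sol (leqnn N).
  have := dotv_lower rNs (gC _ rNs); rewrite -(scheme_phiN sol) /E; lra.
have low := scheme_phi_lower N0 sol CH0 HC up low0.
have phiM n : (n <= N)%N -> `|phi n| <= M1 + U.
  move=> nN; apply: interval_norm_le => // i; last exact: up.
  by apply: le_trans (low n i nN); rewrite -/M1 lerDr.
have gradM n : (n <= N)%N -> `|gradG G (phi n)| <= M2.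
  move=> nN; apply: le_trans (gradG_le G _) _; rewrite ler_wpM2l ?phiM//.
  by rewrite mulr_ge0// opnorm_graph_ge0.
have rlow := scheme_rho_lower hrho0 N0 sol Cn0 flux
  (fun n nN => conj (skewE_gradG G (phi n)) (gradM n nN)).
move=> n nN; split; last 2 first.
- by rewrite le_max phiM.
- by rewrite le_max gradM// orbT.
by have [rs _] := scheme_simplex_int sol nN; split=> // i; exact: rlow.
Qed.

End APriori.

(** * A priori bounds for the exact solution *)

Section ExactSolution.
Variables (R : realType) (d : nat) (G : wgraph R d).
Variables (H : 'rV[R]_d -> 'M[R]_d -> 'rV[R]_d).
Variables (B : 'rV[R]_d -> 'M[R]_d -> 'M[R]_d).
Variables (g : 'rV[R]_d -> 'rV[R]_d).
Hypothesis hA : assumptionA G H B g.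
Variables (T eps : R).
Hypotheses (hT : 0 < T) (eps0 : 0 < eps).

Section Flow.
Variables (rho0 : 'rV[R]_d) (phi rho dphi drho : R -> 'rV[R]_d).
Hypothesis hrho0 : simplex_eps eps rho0.
Hypothesis phi_d : has_tderiv `[0, T] phi dphi.
Hypothesis rho_d : has_tderiv `[0, T] rho drho.
Hypothesis flow : forall t, t \in `[0, T] ->
  [/\ simplex_int (rho t),
      dphi t = H (rho t) (gradG G (phi t)) - lapG G (phi t) &
      drho t = divG G (B (rho t) (gradG G (phi t))) + lapG G (rho t)].
Hypothesis rho_start : rho 0 = rho0.
Hypothesis phi_end : phi T = g (rho T).

Let t0T : 0 \in `[0, T]. Proof. by rewrite in_itv/= lexx ltW. Qed.
Let tTT : T \in `[0, T]. Proof. by rewrite in_itv/= lexx ltW. Qed.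

Let phi_i i := has_tderiv_entry (i := 0) (j := i) phi_d.
Let rho_i i := has_tderiv_entry (i := 0) (j := i) rho_d.

Lemma flow_simplex_int t : t \in `[0, T] -> simplex_int (rho t).
Proof. by move=> /flow[]. Qed.

(** The slope [CH + 1] exceeds [CH], so that at a minimum of the barrier
    before the final time the derivative would have the wrong strict sign. *)
Lemma flow_phi_upper CH Cg : 0 <= CH ->
  (forall rho p, simplex_int rho -> skewE G p ->
    forall i, H rho p 0 i >= - CH) ->
  (forall rho, simplex rho -> norm_sup (g rho) <= Cg) ->
  forall t i, t \in `[0, T] -> phi t 0 i <= Cg + (CH + 1) * T.
Proof.
move=> CH0 HC gC t i tT.
pose v j s := (Cg + (CH + 1) * T) - (CH + 1) * s - phi s 0 j.
have dv j : has_rderiv `[0, T] (v j) (fun s => 0 - (CH + 1) * 1 - dphi s 0 j).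
  have d1 := has_rderivZ (c := CH + 1) (@has_rderiv_id R `[0, T]%classic).
  exact (has_rderivB (has_rderivB (has_rderiv_cst (Cg + (CH + 1) * T)) d1)
    (@phi_i j)).
have [m [s [sT smin _ sr]]] := family_minimum i (ltW hT) dv.
have sE : s = T.
  apply/eqP; rewrite eq_le (itvP sT)/= leNgt; apply/negP => /sr.
  have [rs -> _] := flow sT.
  have mmax j : phi s 0 j <= phi s 0 m by have := smin j s sT; rewrite /v; lra.
  have := lapG_max G mmax; have := HC _ _ rs (skewE_gradG G (phi s)) m.
  by rewrite entryB; lra.
have gT : phi T 0 m <= Cg.
  by rewrite phi_end; apply: norm_sup_entry_le; apply: gC;
    have [] := flow_simplex_int tTT.
have := smin i t tT; rewrite sE /v.
have t0 : 0 <= t by rewrite (itvP tT).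
have : 0 <= (CH + 1) * t by rewrite mulr_ge0// addr_ge0.
lra.
Qed.

Lemma flow_energy C0 :
  (forall rho p, simplex_int rho -> skewE G p ->
      dotE G (B rho p) p >= dotv (H rho p) rho - C0) ->
  dotv (phi T) (rho T) - T * C0 <= dotv (phi 0) (rho 0).
Proof.
move=> coer; have df := has_rderiv_dotv phi_d rho_d.
have := @has_rderiv_le _ 0 T C0 _ _ (ltW hT) df _.
rewrite subr0 mulrC lerBlDl lerBlDr => -> // t tT.
have [rs -> ->] := flow tT; have ps := skewE_gradG G (phi t).
have := duality_rate (phi t) (rho t) (H (rho t) (gradG G (phi t))) 0
  (A_B_skew hA rs ps).
rewrite addr0 => ->.
have -> : dotv (phi t) 0 = 0 by rewrite -(scale0r (phi t)) dotvZr mul0r.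
by have := coer _ _ rs ps; lra.
Qed.

Lemma flow_phi_lower CH U A0 : 0 <= CH ->
  (forall rho p, simplex_int rho -> skewE G p ->
    forall i, H rho p 0 i >= - CH) ->
  (forall t i, t \in `[0, T] -> phi t 0 i <= U) ->
  (forall i, - A0 <= phi 0 0 i) ->
  forall t i, t \in `[0, T] ->
  U - (U + A0 + 1) * expR ((total_weight G + CH) * T) <= phi t 0 i.
Proof.
move=> CH0 HC phiU phiA t i tT; set L := total_weight G + CH.
have W0 := total_weight_ge0 G.
have t0 : 0 <= t by rewrite (itvP tT).
have tT' : t <= T by rewrite (itvP tT).
have UA0 : 0 <= U + A0 + 1 by have := phiU 0 i t0T; have := phiA i; lra.
pose f s := expR (- L * s) * (U + 1 - phi s 0 i).
have df : has_rderiv `[0, T] f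
    (fun s => - L * expR (- L * s) * (U + 1 - phi s 0 i)
              + expR (- L * s) * (0 - dphi s 0 i)).
  exact (has_rderivM (@has_rderiv_exp _ _ (- L))
    (has_rderivB (has_rderiv_cst (U + 1)) (@phi_i i))).
have sub : `[0, t]%classic `<=` `[0, T]%classic.
  by move=> s /=; rewrite !in_itv/= => /andP[-> /le_trans->].
have : f t - f 0 <= 0 * (t - 0).
  apply: has_rderiv_le (has_rderiv_subset sub df) _ => // s sI.
  have sT : s \in `[0, T] by exact: sub.
  have [rs -> _] := flow sT.
  have := HC _ _ rs (skewE_gradG G (phi s)) i.
  have := lapG_le_gap G i (fun j => phiU s j sT).
  have := phiU s i sT.
  rewrite entryB; set h := H _ _ _ _; set l := lapG _ _ _ _; set p := phi s 0 i.
  move=> pU gap hC.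
  have -> : - L * expR (- L * s) * (U + 1 - p) + expR (- L * s) * (0 - (h - l))
      = expR (- L * s) * (l - h - L * (U + 1 - p)) by ring.
  apply: mulr_ge0_le0; first exact: expR_ge0.
  rewrite /L; nra.
rewrite mul0r subr_le0 /f mulr0 expR0 mul1r mulNr expRN => ft.
have et : expR (L * t) <= expR (L * T).
  by rewrite ler_expR ler_wpM2l// addr_ge0.
have : U + 1 - phi t 0 i <= (U + 1 - phi 0 0 i) * expR (L * t).
  by rewrite -ler_pdivrMr ?expR_gt0// mulrC.
have := phiA i; have := expR_gt0 (L * t); have := phiU 0 i t0T.
nra.
Qed.

(** With the rate [C + 1] instead of [C] the weighted least density strictly
    increases, so its minimum over time is the initial one. *)
Lemma flow_rho_lower C P : 0 <= C ->
  (forall rho p i, simplex_int rho -> P p ->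
    (forall j, rho 0 i <= rho 0 j) ->
    - C * rho 0 i <= (divG G (B rho p) + lapG G rho) 0 i) ->
  (forall t, t \in `[0, T] -> P (gradG G (phi t))) ->
  forall t i, t \in `[0, T] -> eps * expR (- ((C + 1) * T)) <= rho t 0 i.
Proof.
move=> C0 flux phiP t i tT.
pose v j s := expR ((C + 1) * s) * rho s 0 j.
have dv j : has_rderiv `[0, T] (v j) (fun s =>
    (C + 1) * expR ((C + 1) * s) * rho s 0 j + expR ((C + 1) * s) * drho s 0 j).
  exact (has_rderivM (@has_rderiv_exp _ _ (C + 1)) (@rho_i j)).
have [m [s [sT smin sl _]]] := family_minimum i (ltW hT) dv.
have sE : s = 0.
  apply/eqP; rewrite eq_le (itvP sT) andbT leNgt; apply/negP => /sl.
  have [rs _ ->] := flow sT.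
  have mmin j : rho s 0 m <= rho s 0 j.
    by have := smin j s sT; rewrite /v ler_pM2l ?expR_gt0.
  have := flux _ _ m rs (phiP s sT) mmin.
  have [_ /(_ m) rm] := rs; have := expR_gt0 ((C + 1) * s).
  nra.
have := smin i t tT; rewrite sE /v mulr0 expR0 mul1r rho_start => H0.
have [_ /(_ m) em] := hrho0.
have [_ /(_ i) ri] := flow_simplex_int tT.
rewrite expRN ler_pdivrMr ?expR_gt0// mulrC; apply: le_trans em _.
apply: le_trans H0 _; rewrite ler_pM2r// ler_expR ler_wpM2l ?addr_ge0//.
by rewrite (itvP tT).
Qed.

End Flow.

Lemma exact_a_priori : exists delta M : R, 0 < delta /\ 0 <= M /\
  forall rho0, simplex_eps eps rho0 ->
  forall phi rho, exact_solution G H B g T rho0 phi rho ->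
  forall t, t \in `[0, T] ->
    [/\ simplex_eps delta (rho t), `|phi t| <= M & `|gradG G (phi t)| <= M].
Proof.
have [C0 C00 coer] := A_coercive hA; have [CH CH0 HC] := A_H_lower hA.
have [Cg Cg0 gC] := A_g_bounded hA; have [a aB] := A_flux hA.
pose U := Cg + (CH + 1) * T; pose E := Cg + T * C0; pose A0 := (E + U) / eps.
pose M1 := (U + A0 + 1) * expR ((total_weight G + CH) * T).
have U0 : 0 <= U by rewrite addr_ge0// mulr_ge0 ?addr_ge0// ltW.
have E0 : 0 <= E by rewrite addr_ge0// mulr_ge0// ltW.
have A00 : 0 <= A0 by apply: divr_ge0; [exact: addr_ge0|exact: ltW].
have M10 : 0 <= M1.
  by apply: mulr_ge0; [rewrite addr_ge0// addr_ge0|exact: expR_ge0].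
pose M2 := 2 * opnorm_graph G * (M1 + U).
have [C Cn0 flux] := flux_compact aB (P := [set p | skewE G p /\ `|p| <= M2])
  (fun p ps => ps.1) (@compact_skewE_ball _ _ G M2).
exists (eps * expR (- ((C + 1) * T))), (Num.max (M1 + U) M2).
split; first by rewrite mulr_gt0 ?expR_gt0.
split; first by rewrite le_max (addr_ge0 M10 U0).
move=> rho0 hrho0 phi rho
  [dphi [drho [[phi_d _] [[rho_d _] [flow [start end_]]]]]].
have up := flow_phi_upper phi_d flow end_ CH0 HC gC.
have t0T : 0 \in `[0, T] by rewrite in_itv/= lexx ltW.
have tTT : T \in `[0, T] by rewrite in_itv/= lexx ltW.
have low0 : forall i, - A0 <= phi 0 0 i.
  apply: (dotv_entry_lower eps0 E0 U0 hrho0) => [j|]; first exact: up.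
  rewrite -start; apply: le_trans (flow_energy phi_d rho_d flow coer).
  have [[rTs _] _ _] := flow T tTT.
  have := dotv_lower rTs (gC _ rTs); rewrite -end_ /E; lra.
have low := flow_phi_lower phi_d flow CH0 HC up low0.
have phiM t : t \in `[0, T] -> `|phi t| <= M1 + U.
  move=> tT; apply: interval_norm_le => // i; last exact: up.
  by apply: le_trans (low t i tT); rewrite -/M1 lerDr.
have gradM t : t \in `[0, T] -> `|gradG G (phi t)| <= M2.
  move=> tT; apply: le_trans (gradG_le G _) _; rewrite ler_wpM2l ?phiM//.
  by rewrite mulr_ge0// opnorm_graph_ge0.
have rlow := flow_rho_lower hrho0 rho_d flow start Cn0 flux
  (fun t tT => conj (skewE_gradG G (phi t)) (gradM t tT)).
move=> t tT; split; last 2 first.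
- by rewrite le_max phiM.
- by rewrite le_max gradM// orbT.
by have [[rs _] _ _] := flow t tT; split=> // i; exact: rlow.
Qed.

End ExactSolution.

(** * Stability of the scheme *)

Section Stability.
Variables (R : realType) (d : nat) (G : wgraph R d).

(** Cauchy-Schwarz against the constant 1, from the variance of [V]. *)
Lemma sum_sqr_le N (V : 'I_N -> R) :
  (\sum_k V k) ^+ 2 <= N%:R * \sum_k V k ^+ 2.
Proof.
case: N V => [|N] V; first by rewrite !big_ord0 expr0n mulr0.
set S := \sum_k V k; set Q := \sum_k _.
have N0 : 0 < N.+1%:R :> R by rewrite ltr0n.
pose m := S / N.+1%:R.
have mE : N.+1%:R * m = S by rewrite mulrC divfK// gt_eqF.
have : 0 <= \sum_k (V k - m) ^+ 2 by apply: sumr_ge0 => k _; exact: sqr_ge0.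
have -> : \sum_k (V k - m) ^+ 2 = Q - 2 * m * S + N.+1%:R * m ^+ 2.
  rewrite (eq_bigr (fun k => V k ^+ 2 - 2 * m * V k + m ^+ 2)); last first.
    by move=> k _; ring.
  rewrite big_split/= sumrB -mulr_sumr sumr_const card_ord.
  by rewrite -[X in _ + X]mulr_natl.
by rewrite -mE => H; nra.
Qed.

Lemma telescope_norm_le (U : normedModType R) N (x : nat -> U) (b : nat -> R) :
  (forall k, 0 <= b k) ->
  (forall k, (k < N)%N -> `|x k.+1 - x k| <= b k) ->
  forall m n, (m <= n <= N)%N -> `|x n - x m| <= \sum_(k < N) b k.
Proof.
move=> b0 xb m n /andP[mn nN]; rewrite -telescope_sumr//.
apply: (le_trans (ler_norm_sum _ _ _)).
rewrite -(big_mkord xpredT b) [leRHS](big_cat_nat (n := m))//=; last first.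
  exact: leq_trans nN.
rewrite [X in _ <= _ + X](big_cat_nat (n := n))//= addrCA.
apply: (@le_trans _ _ (\sum_(m <= k < n) b k)).
  rewrite big_nat_cond [leRHS]big_nat_cond; apply: ler_sum => k.
  by rewrite andbT => /andP[_ kn]; apply: xb; exact: (leq_trans kn nN).
by rewrite lerDl addr_ge0//; apply: sumr_ge0.
Qed.

Lemma telescope_sum_ord (f : nat -> R) N :
  f N - f 0%N = \sum_(k < N) (f k.+1 - f k).
Proof.
by rewrite -(big_mkord xpredT (fun k => f k.+1 - f k)) telescope_sumr.
Qed.

Variables (H : 'rV[R]_d -> 'M[R]_d -> 'rV[R]_d).
Variables (B : 'rV[R]_d -> 'M[R]_d -> 'M[R]_d).
Variables (g : 'rV[R]_d -> 'rV[R]_d).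
Hypotheses (hA : assumptionA G H B g) (hB : assumptionB G H B g).
Variable T : R.
Hypothesis hT : 0 < T.

(** A trajectory of the scheme up to residuals [a] and [b], confined to a
    compact part of the phase space. *)
Record perturbed (delta M : R) (N : nat) (a b phi rho : nat -> 'rV[R]_d) :
  Prop := {
  pert_phi : forall n, (n < N)%N -> phi n.+1 - phi n =
    (T / N%:R) *: (H (rho n.+1) (gradG G (phi n)) - lapG G (phi n) + a n);
  pert_rho : forall n, (n < N)%N -> rho n.+1 - rho n =
    (T / N%:R) *:
      (divG G (B (rho n.+1) (gradG G (phi n))) + lapG G (rho n.+1) + b n);
  pert_end : phi N = g (rho N);
  pert_box : forall n, (n <= N)%N -> simplex_eps delta (rho n);
  pert_grad : forall n, (n <= N)%N -> `|gradG G (phi n)| <= M }.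

Lemma perturbed_phase delta M N a b phi rho n :
  perturbed delta M N a b phi rho -> (n < N)%N ->
  phase_box G delta M (rho n.+1, gradG G (phi n)).
Proof.
move=> tr nN; split; first exact: pert_box tr _ nN.
by split; [exact: skewE_gradG|apply: pert_grad tr _ _; exact: ltnW].
Qed.

(** Densities have mass one, and both the divergence and the Laplacian conserve
    mass, which leaves no mass for the residual. *)
Lemma perturbed_mass delta M N a b phi rho n : 0 < delta -> (0 < N)%N ->
  perturbed delta M N a b phi rho -> (n < N)%N -> tangent0 (b n).
Proof.
move=> d0 N0 tr nN; have [ps _] := phase_box_phase d0 (perturbed_phase tr nN).
have tn0 : T / N%:R != 0 by rewrite mulf_neq0 ?invr_neq0 ?pnatr_eq0 ?gt_eqF//
  -lt0n.
have sum0 : tangent0 (rho n.+1 - rho n).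
  apply: simplexB; first by have [] := pert_box tr nN.
  by have [] := pert_box tr (ltnW nN).
have Bs := A_B_skew hA ps (skewE_gradG G (phi n)).
have := sum0; rewrite (pert_rho tr nN) /tangent0/=.
rewrite (eq_bigr
  (fun i => T / N%:R * (divG G (B (rho n.+1) (gradG G (phi n))) 0 i
  + lapG G (rho n.+1) 0 i + b n 0 i))); last first.
  by move=> i _; rewrite entryZ !entryD.
rewrite -mulr_sumr !big_split/= sum_divG// sum_divG; last exact: skewE_gradG.
by rewrite !add0r => /eqP; rewrite mulf_eq0 (negPf tn0) => /eqP.
Qed.

(** Monotonicity turns the duality identity into control of
    [rho n.+1 - rho' n.+1] and of the gradient of [phi n - phi' n] in l2 over
    time, linear in the residuals; the equations themselves then propagate this
    to pointwise bounds, forward for the density and backward for [phi]. *)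
Lemma stability delta M : 0 < delta -> exists2 C : R, 0 <= C &
  forall N kappa a b phi rho phi' rho', (0 < N)%N -> 0 <= kappa ->
  perturbed delta M N a b phi rho ->
  perturbed delta M N (fun=> 0) (fun=> 0) phi' rho' ->
  rho 0%N = rho' 0%N ->
  (forall n, (n < N)%N -> `|a n| <= kappa) ->
  (forall n, (n < N)%N -> `|b n| <= kappa) ->
  (forall n, (n <= N)%N -> `|rho n - rho' n| <= C * kappa /\
                           `|phi n - phi' n| <= C * kappa) /\
  T / N%:R * \sum_(n < N) `|gradG G (phi n) - gradG G (phi' n)| ^+ 2
    <= (C * kappa) ^+ 2.
Proof.
move=> delta0.
have [c c0 mono] := HB_monotone hA hB M delta0.
have [LH LH0 lipH] := C1_lipschitz_box M delta0 (A_H_C1 hA).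
have [LB LB0 lipB] := C1_lipschitz_box M delta0 (A_B_C1 hA).
have [Lg Lg0 lipg] : exists2 L : R, 0 <= L &
    forall x y, simplex x -> simplex y -> `|g x - g y| <= L * `|x - y|.
  apply: (C1_lipschitz (A_g_C1 hA) (@framed_tangent0 _ _)) => //.
  - by rewrite simplexE; exact: compact_simplex_eps.
  - by rewrite simplexE; exact: convex_simplex_eps.
  - by move=> x y; exact: simplexB.
have [Cp Cp0 poinc] := poincare_tangent0 G.
set w := opnorm_graph G; have w0 : 0 <= w := opnorm_graph_ge0 G.
(* [T * Q * kappa] will bound the time integral of the error [V]; [Cr] and [Ce]
   add what one step of each equation contributes, [Ce] starting from the
   final condition. *)
pose K := d%:R + Cp; have K0 : 0 <= K by rewrite addr_ge0.
pose K1 := w * LB + 2 * w ^+ 2.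
have K10 : 0 <= K1 by rewrite addr_ge0// mulr_ge0// sqr_ge0.
pose K2 := LH + w; have K20 : 0 <= K2 by rewrite addr_ge0.
pose Q := K / c; have Q0 : 0 <= Q by apply: divr_ge0 K0 (ltW c0).
pose Cr := K1 * (T * Q) + T; pose Ce := Lg * Cr + K2 * (T * Q) + T.
have T0 := ltW hT.
have TQ0 : 0 <= T * Q by rewrite mulr_ge0.
have Cr0 : 0 <= Cr by rewrite addr_ge0// mulr_ge0.
have Ce0 : 0 <= Ce by rewrite !addr_ge0// mulr_ge0.
exists (Cr + Ce + (T + 1) * Q) =>
  [|N kappa a b phi rho phi' rho' N0 k0 tr tr' start ak bk].
  by rewrite !addr_ge0// mulr_ge0// addr_ge0.
set tau := T / N%:R.
have NR0 : 0 < N%:R :> R by rewrite ltr0n.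
have tau0 : 0 < tau by rewrite divr_gt0.
have Ntau : N%:R * tau = T by rewrite mulrC divfK// gt_eqF.
pose e n := phi n - phi' n; pose r n := rho n - rho' n.
pose x n := (rho n.+1, gradG G (phi n));
  pose x' n := (rho' n.+1, gradG G (phi' n)).
pose V n : R := `|x n - x' n|.
have V0 n : 0 <= V n by exact: normr_ge0.
have rV n : `|r n.+1| <= V n by rewrite [leRHS]prod_normE le_max lexx.
have gV n : `|gradG G (e n)| <= V n.
  by rewrite /e gradGB [leRHS]prod_normE le_max lexx orbT.
pose dH n := H (rho n.+1) (gradG G (phi n)) - H (rho' n.+1) (gradG G (phi' n)).
pose dB n := B (rho n.+1) (gradG G (phi n)) - B (rho' n.+1) (gradG G (phi' n)).
have eE n : (n < N)%N -> e n.+1 - e n = tau *: (dH n + a n - lapG G (e n)).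
  move=> nN; have -> : e n.+1 - e n = (phi n.+1 - phi n) - (phi' n.+1 - phi' n).
    by rewrite /e !opprB addrACA [RHS]addrACA [- phi n + _]addrC.
  rewrite (pert_phi tr nN) (pert_phi tr' nN) -scalerBr /dH lapGB;
    congr (_ *: _).
  move: (H _ _) (H _ _) (lapG _ _) (lapG _ _) => h h' l l'.
  by apply/rowP => i; rewrite !mxE; ring.
have rE n : (n < N)%N -> r n.+1 - r n = tau *:
  (divG G (dB n) + lapG G (r n.+1) + b n).
  move=> nN; have -> : r n.+1 - r n = (rho n.+1 - rho n) - (rho' n.+1 - rho' n).
    by rewrite /r !opprB addrACA [RHS]addrACA [- rho n + _]addrC.
  rewrite (pert_rho tr nN) (pert_rho tr' nN) -scalerBr /dB lapGB divGB.
  congr (_ *: _).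
  move: (divG _ _) (divG _ _) (lapG _ _) (lapG _ _) => h h' l l'.
  by apply/rowP => i; rewrite !mxE; ring.
have step n : (n < N)%N -> dotv (e n.+1) (r n.+1) - dotv (e n) (r n)
    <= tau * (K * kappa * V n - c * V n ^+ 2).
  move=> nN; have px := perturbed_phase tr nN;
    have px' := perturbed_phase tr' nN.
  have [ps gs] := phase_box_phase delta0 px;
    have [ps' gs'] := phase_box_phase delta0 px'.
  have dBs : skewE G (dB n) by apply: skewEB; exact: (A_B_skew hA).
  rewrite (duality_step dBs (eE n nN) (rE n nN)) ler_pM2l//.
  have := mono _ _ px px';
    rewrite -/(V n) /= -/(dH n) -/(dB n) -/(r n.+1) -gradGB -/(e n).
  have := poinc (e n) (b n) (perturbed_mass delta0 N0 tr nN).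
  have := dotv_le (a n) (r n.+1).
  rewrite !ler_norml dotvDl => /andP[_ ar] /andP[_ eb] m.
  have : d%:R * `|a n| * `|r n.+1| <= d%:R * kappa * V n.
    by rewrite -!mulrA ler_wpM2l// ler_pM// ak.
  have : Cp * `|gradG G (e n)| * `|b n| <= Cp * V n * kappa.
    by rewrite -!mulrA ler_wpM2l// ler_pM// bk.
  rewrite /K; lra.
pose S := \sum_(n < N) V n; pose Q2 := \sum_(n < N) V n ^+ 2.
have S0 : 0 <= S by apply: sumr_ge0.
(* The end terms of the telescoped identity have a sign: the densities agree
   at time 0, and [g] is monotone at the final time. *)
have energy : c * Q2 <= K * kappa * S.
  have : 0 <= dotv (e N) (r N) - dotv (e 0%N) (r 0%N).
    have -> : r 0%N = 0 by rewrite /r start subrr.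
    rewrite -[X in dotv (e 0%N) X](scale0r (r N)) dotvZr mul0r subr0.
    rewrite /e (pert_end tr) (pert_end tr'); apply: (B_g_monotone hB).
      exact: simplex_int_eps delta0 _ (pert_box tr (leqnn N)).
    exact: simplex_int_eps delta0 _ (pert_box tr' (leqnn N)).
  rewrite (telescope_sum_ord (fun n => dotv (e n) (r n))) => le0.
  have := le_trans le0 (ler_sum _ (fun (n : 'I_N) _ => step n (ltn_ord n))).
  by rewrite -mulr_sumr pmulr_rge0// sumrB -!mulr_sumr subr_ge0.
have cQ : c * Q = K by rewrite mulrC divfK// gt_eqF.
have CS : S ^+ 2 <= N%:R * Q2 by exact: sum_sqr_le.
have SQ : S <= N%:R * (Q * kappa).
  have [->|Sn0] := eqVneq S 0;
    first by apply: mulr_ge0 (ler0n _ _) (mulr_ge0 Q0 k0).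
  have Sp : 0 < S by rewrite lt0r Sn0.
  rewrite -(ler_pM2r Sp) -(ler_pM2l c0).
  have -> : c * (N%:R * (Q * kappa) * S) = N%:R * (K * kappa * S).
    by rewrite -cQ; ring.
  apply: (@le_trans _ _ (N%:R * (c * Q2))); last by rewrite ler_pM2l.
  by rewrite [leRHS]mulrCA ler_pM2l// -expr2.
have tauS : tau * S <= T * Q * kappa.
  rewrite -(ler_pM2l tau0) in SQ; apply: le_trans SQ _.
  by rewrite -[X in _ <= X * _ * _]Ntau le_eqVlt; apply/orP; left; apply/eqP;
    ring.
have tauQ2 : tau * Q2 <= T * (Q * kappa) ^+ 2.
  have : Q2 <= Q * kappa * S.
    by rewrite -(ler_pM2l c0) mulrA mulrA cQ.
  rewrite -(ler_pM2l tau0) => /le_trans; apply.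
  have : Q * kappa * (tau * S) <= Q * kappa * (T * Q * kappa).
    by rewrite ler_wpM2l// mulr_ge0.
  by rewrite mulrCA expr2 => /le_trans; apply; rewrite le_eqVlt; apply/orP;
    left; apply/eqP; ring.
have rstep n : (n < N)%N -> `|r n.+1 - r n| <= tau * (K1 * V n + kappa).
  move=> nN; rewrite rE// normrZ gtr0_norm// ler_pM2l//.
  have px := perturbed_phase tr nN; have px' := perturbed_phase tr' nN.
  apply: le_trans (ler_normD _ _) _; apply: lerD; last exact: bk.
  apply: le_trans (ler_normD _ _) _; rewrite mulrDl; apply: lerD.
    apply: le_trans (divG_le G _) _; rewrite -mulrA ler_wpM2l//.
    exact: lipB px px'.
  apply: le_trans (lapG_le G _) _; rewrite ler_wpM2l//.
  by rewrite mulr_ge0// sqr_ge0.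
have estep n : (n < N)%N -> `|e n.+1 - e n| <= tau * (K2 * V n + kappa).
  move=> nN; rewrite eE// normrZ gtr0_norm// ler_pM2l//.
  have px := perturbed_phase tr nN; have px' := perturbed_phase tr' nN.
  apply: le_trans (ler_normB _ _) _; rewrite /K2 mulrDl [leRHS]addrAC.
  apply: lerD.
    apply: le_trans (ler_normD _ _) _; apply: lerD; last exact: ak.
    exact: lipH px px'.
  by apply: le_trans (divG_le G _) _; rewrite ler_wpM2l.
have sumV Kx : 0 <= Kx ->
    \sum_(n < N) tau * (Kx * V n + kappa) <= (Kx * (T * Q) + T) * kappa.
  move=> Kx0; rewrite -mulr_sumr big_split/= -mulr_sumr sumr_const card_ord.
  rewrite -[X in _ + X]mulr_natl.
  have -> : tau * (Kx * S + N%:R * kappa) = Kx * (tau * S) + T * kappa.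
    by rewrite -[in RHS]Ntau; ring.
  by rewrite mulrDl lerD2r -mulrA ler_wpM2l.
have pos Kx n : 0 <= Kx -> 0 <= tau * (Kx * V n + kappa).
  by move=> Kx0; rewrite mulr_ge0 ?(ltW tau0)// addr_ge0// mulr_ge0.
have rbound n : (n <= N)%N -> `|r n| <= Cr * kappa.
  move=> nN; apply: le_trans (sumV _ K10).
  have := telescope_norm_le (fun k => pos K1 k K10) rstep (m := 0%N) (n := n).
  by rewrite leq0n nN /= {2}/r start subrr subr0; apply.
have ebound n : (n <= N)%N -> `|e n| <= Ce * kappa.
  move=> nN; have -> : e n = e N - (e N - e n) by rewrite subKr.
  have -> : Ce * kappa = Lg * Cr * kappa + (K2 * (T * Q) + T) * kappa.
    by rewrite /Ce; ring.
  apply: le_trans (ler_normB _ _) _; apply: lerD.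
    rewrite /e (pert_end tr) (pert_end tr').
    have [[rs _] [rs' _]] := (pert_box tr (leqnn N), pert_box tr' (leqnn N)).
    apply: le_trans (lipg _ _ rs rs') _; rewrite -mulrA ler_wpM2l//.
    exact: rbound.
  apply: le_trans (sumV _ K20).
  have := telescope_norm_le (fun k => pos K2 k K20) estep (m := n) (n := N).
  by rewrite nN leqnn /=; apply.
have TQ1 : 0 <= (T + 1) * Q by rewrite mulr_ge0// addr_ge0.
split=> [n nN|].
  split; [apply: le_trans (rbound n nN) _|apply: le_trans (ebound n nN) _];
    rewrite ler_wpM2r//; lra.
apply: (@le_trans _ _ (tau * Q2)).
  rewrite ler_pM2l//; apply: ler_sum => n _; rewrite -gradGB.
  by rewrite lerXn2r ?nnegrE//; exact: gV.
apply: le_trans tauQ2 _.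
rewrite (exprMn _ Q) (exprMn _ (Cr + _ + _)) mulrA ler_wpM2r ?sqr_ge0//.
apply: (@le_trans _ _ (((T + 1) * Q) ^+ 2)).
  by rewrite (exprMn _ (T + 1)) ler_wpM2r ?sqr_ge0//; nra.
apply: lerXn2r; rewrite ?nnegrE//; first exact: addr_ge0 (addr_ge0 Cr0 Ce0) TQ1.
by rewrite lerDr; exact: addr_ge0 Cr0 Ce0.
Qed.

End Stability.

(** * Consistency of the exact solution *)

Section Consistency.
Variables (R : realType) (d : nat) (G : wgraph R d).

(** Comparing with a fixed slope [v] covers both uses: [v = 0] gives the
    Lipschitz bound in time, and [v] the right-hand side at the nodes gives the
    truncation error. *)
Lemma tderiv_increment m n (a b c : R) (f f' : R -> 'M[R]_(m, n))
  (v : 'M[R]_(m, n)) :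
  a <= b -> has_tderiv `[a, b] f f' ->
  (forall t, t \in `[a, b] -> `|f' t - v| <= c) ->
  `|f b - f a - (b - a) *: v| <= c * (b - a).
Proof.
move=> ab df fc; have c0 : 0 <= c.
  by apply: le_trans (fc a _); rewrite ?normr_ge0// in_itv/= lexx.
apply: mx_norm_le => [|i j]; first by rewrite mulr_ge0// subr_ge0.
have dfij := has_tderiv_entry (i := i) (j := j) df.
have fcij t : t \in `[a, b] -> `|f' t i j - v i j| <= c.
  by move=> /fc; apply: le_trans; rewrite -entryB; exact: ler_mx_entry.
have up : f b i j - f a i j <= (c + v i j) * (b - a).
  by apply: has_rderiv_le dfij _ => // t /fcij; rewrite ler_norml => /andP[_];
    lra.
have lo : (0 - f b i j) - (0 - f a i j) <= (c - v i j) * (b - a).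
  apply: has_rderiv_le (has_rderivB (has_rderiv_cst 0) dfij) _ => // t /fcij.
  by rewrite ler_norml => /andP[? _]; lra.
by rewrite !entryB entryZ ler_norml; lra.
Qed.

Variables (H : 'rV[R]_d -> 'M[R]_d -> 'rV[R]_d).
Variables (B : 'rV[R]_d -> 'M[R]_d -> 'M[R]_d).
Variables (g : 'rV[R]_d -> 'rV[R]_d).
Hypothesis hA : assumptionA G H B g.
Variable T : R.
Hypothesis hT : 0 < T.

Lemma lipschitz_box_bounded m n (delta M L : R)
  (f : 'rV[R]_d * 'M[R]_d -> 'M[R]_(m, n)) :
  0 <= L ->
  (forall x y, phase_box G delta M x -> phase_box G delta M y ->
     `|f x - f y| <= L * `|x - y|) ->
  exists2 D : R, 0 <= D & forall x, phase_box G delta M x -> `|f x| <= D.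
Proof.
move=> L0 fL.
have [[x0 Kx0]|K0] := pselect (phase_box G delta M !=set0); last first.
  by exists 0 => // x Kx; exfalso; apply: K0; exists x.
have xM x : phase_box G delta M x -> `|x| <= 1 + `|M|.
  move=> [x1 [_ x2]]; rewrite prod_normE ge_max; apply/andP; split.
    apply: le_trans (simplex_norm x1.1) _; by rewrite lerDl.
  by apply: le_trans x2 _; apply: le_trans (ler_norm M) _; rewrite lerDr.
exists (`|f x0| + L * (2 * (1 + `|M|))) => [|x Kx].
  by rewrite addr_ge0// !mulr_ge0// addr_ge0.
have -> : f x = f x0 + (f x - f x0) by rewrite addrC subrK.
apply: le_trans (ler_normD _ _) _; rewrite lerD2l.
apply: le_trans (fL _ _ Kx Kx0) _; rewrite ler_wpM2l//.
apply: le_trans (ler_normB _ _) _.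
by have := xM _ Kx; have := xM _ Kx0; lra.
Qed.

Section ExactTrajectory.
Variables (delta M D LH LB : R) (phi rho dphi drho : R -> 'rV[R]_d).
Hypotheses (D0 : 0 <= D) (LH0 : 0 <= LH) (LB0 : 0 <= LB).
Hypothesis lipH : forall x y, phase_box G delta M x -> phase_box G delta M y ->
  `|H x.1 x.2 - H y.1 y.2| <= LH * `|x - y|.
Hypothesis lipB : forall x y, phase_box G delta M x -> phase_box G delta M y ->
  `|B x.1 x.2 - B y.1 y.2| <= LB * `|x - y|.
Hypothesis phi_d : has_tderiv `[0, T] phi dphi.
Hypothesis rho_d : has_tderiv `[0, T] rho drho.
Hypothesis dphiE : forall t, t \in `[0, T] ->
  dphi t = H (rho t) (gradG G (phi t)) - lapG G (phi t).
Hypothesis drhoE : forall t, t \in `[0, T] ->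
  drho t = divG G (B (rho t) (gradG G (phi t))) + lapG G (rho t).
Hypothesis rho_box : forall t, t \in `[0, T] -> simplex_eps delta (rho t).
Hypothesis grad_box : forall t, t \in `[0, T] -> `|gradG G (phi t)| <= M.
Hypothesis dphi_le : forall t, t \in `[0, T] -> `|dphi t| <= D.
Hypothesis drho_le : forall t, t \in `[0, T] -> `|drho t| <= D.

Let w := opnorm_graph G.
(* Lipschitz constant in time of the pair (density, gradient of [phi]). *)
Let Lx := D + 2 * w * D.
Definition consistency_cst := LH * Lx + w * (LB * Lx) + 2 * w ^+ 2 * D.

Lemma consistency_cst_ge0 : 0 <= consistency_cst.
Proof.
have w0 := opnorm_graph_ge0 G;
  have Lx0 : 0 <= Lx by rewrite addr_ge0// !mulr_ge0.
apply: addr_ge0; first by apply: addr_ge0; rewrite !mulr_ge0.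
by rewrite !mulr_ge0// sqr_ge0.
Qed.

Let sub s t : 0 <= s -> t <= T -> `[s, t]%classic `<=` `[0, T]%classic.
Proof.
move=> s0 tT u /=; rewrite !in_itv/= => /andP[su ut].
by rewrite (le_trans s0 su) (le_trans ut tT).
Qed.

Let lip (f df : R -> 'rV[R]_d) s t : has_tderiv `[0, T] f df ->
  (forall u, u \in `[0, T] -> `|df u| <= D) ->
  0 <= s -> s <= t -> t <= T -> `|f t - f s| <= D * (t - s).
Proof.
move=> fd dfD s0 st tT.
have := @tderiv_increment _ _ s t D f df 0 st
  (has_tderiv_subset (sub s0 tT) fd).
rewrite scaler0 subr0; apply => u us; rewrite subr0; apply: dfD; exact: sub us.
Qed.

Lemma exact_box s t : s \in `[0, T] -> t \in `[0, T] ->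
  phase_box G delta M (rho t, gradG G (phi s)).
Proof.
by move=> sT tT; split;
  [exact: rho_box|split; [exact: skewE_gradG|exact: grad_box]].
Qed.

Lemma exact_step_residual s tau : 0 <= s -> 0 < tau -> s + tau <= T ->
  `|tau^-1 *: (phi (s + tau) - phi s)
    - (H (rho (s + tau)) (gradG G (phi s)) - lapG G (phi s))|
      <= consistency_cst * tau /\
  `|tau^-1 *: (rho (s + tau) - rho s)
    - (divG G (B (rho (s + tau)) (gradG G (phi s))) + lapG G (rho (s + tau)))|
    <= consistency_cst * tau.
Proof.
move=> s0 tau0 stT; set t := s + tau.
have w0 : 0 <= w := opnorm_graph_ge0 G.
have Lx0 : 0 <= Lx by rewrite addr_ge0// !mulr_ge0.
have st : s <= t by rewrite lerDl ltW.
have tsE : t - s = tau by rewrite /t addrAC subrr add0r.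
have sT : s \in `[0, T] by rewrite in_itv/= s0 (le_trans st).
have tT : t \in `[0, T] by rewrite in_itv/= stT (le_trans s0 st).
have phi_lip u : u \in `[s, t] -> `|phi u - phi s| <= D * tau.
  rewrite in_itv/= => /andP[su ut].
  apply: le_trans (lip phi_d dphi_le s0 su (le_trans ut stT)) _.
  by rewrite ler_wpM2l// -tsE lerD2r.
have rho_lip u : u \in `[s, t] -> `|rho u - rho t| <= D * tau.
  rewrite in_itv/= => /andP[su ut]; rewrite distrC.
  apply: le_trans (lip rho_d drho_le (le_trans s0 su) ut stT) _.
  by rewrite ler_wpM2l// -tsE lerD2l lerN2.
have uT u : u \in `[s, t] -> u \in `[0, T] by exact: sub.
have x_lip u : u \in `[s, t] ->
    `|(rho u, gradG G (phi u)) - (rho t, gradG G (phi s))| <= Lx * tau.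
  move=> us; rewrite [leLHS]prod_normE ge_max /=; apply/andP; split.
    apply: le_trans (rho_lip u us) _; rewrite ler_wpM2r ?(ltW tau0)//.
    by rewrite lerDl !mulr_ge0.
  rewrite -gradGB; apply: le_trans (gradG_le G _) _.
  have h1 : 2 * w * `|phi u - phi s| <= 2 * w * (D * tau).
    by rewrite ler_wpM2l ?phi_lip// mulr_ge0.
  have h2 : 0 <= D * tau by rewrite mulr_ge0// ltW.
  by rewrite /Lx -/w; lra.
have scale (f : R -> 'rV[R]_d) v c : `|f t - f s - (t - s) *:
  v| <= c * (t - s) ->
    `|tau^-1 *: (f t - f s) - v| <= c.
  rewrite tsE => fv; have -> : tau^-1 *: (f t - f s) - v
      = tau^-1 *: (f t - f s - tau *: v).
    by rewrite [RHS]scalerBr scalerA mulVf ?scale1r// gt_eqF.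
  by rewrite normrZ gtr0_norm ?invr_gt0// ler_pdivrMl// mulrC.
have lap0 : 0 <= 2 * w ^+ 2 by rewrite mulr_ge0// sqr_ge0.
split; apply: scale.
  apply: tderiv_increment (has_tderiv_subset (sub s0 stT) phi_d) _ => // u us.
  rewrite (dphiE (uT _ us)).
  have -> : H (rho u) (gradG G (phi u)) - lapG G (phi u)
      - (H (rho t) (gradG G (phi s)) - lapG G (phi s))
      = (H (rho u) (gradG G (phi u)) - H (rho t) (gradG G (phi s)))
        - lapG G (phi u - phi s).
    rewrite lapGB; move: (H _ _) (H _ _) (lapG _ _) (lapG _ _) => h h' l l'.
    by apply/rowP => i; rewrite !mxE; ring.
  apply: le_trans (ler_normB _ _) _.
  have := lipH (exact_box (uT _ us) (uT _ us)) (exact_box sT tT).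
  rewrite /= => /le_trans /(_ (ler_wpM2l LH0 (x_lip u us))) h1.
  have h2 := le_trans (lapG_le G (phi u - phi s))
    (ler_wpM2l lap0 (phi_lip u us)).
  have h3 : 0 <= w * (LB * Lx) * tau by apply: mulr_ge0 (ltW tau0);
    rewrite !mulr_ge0.
  rewrite /consistency_cst; lra.
apply: tderiv_increment (has_tderiv_subset (sub s0 stT) rho_d) _ => // u us.
rewrite (drhoE (uT _ us)).
have -> : divG G (B (rho u) (gradG G (phi u))) + lapG G (rho u)
    - (divG G (B (rho t) (gradG G (phi s))) + lapG G (rho t))
    = divG G (B (rho u) (gradG G (phi u)) - B (rho t) (gradG G (phi s)))
      + lapG G (rho u - rho t).
  rewrite lapGB divGB;
    move: (divG _ _) (divG _ _) (lapG _ _) (lapG _ _) => h h' l l'.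
  by apply/rowP => i; rewrite !mxE; ring.
apply: le_trans (ler_normD _ _) _.
have := lipB (exact_box (uT _ us) (uT _ us)) (exact_box sT tT).
rewrite /= => /le_trans /(_ (ler_wpM2l LB0 (x_lip u us))) h1.
have h1' := le_trans (divG_le G _) (ler_wpM2l w0 h1).
have h2 := le_trans (lapG_le G (rho u - rho t)) (ler_wpM2l lap0 (rho_lip u us)).
have h3 : 0 <= LH * Lx * tau by apply: mulr_ge0 (ltW tau0); rewrite !mulr_ge0.
rewrite /consistency_cst; lra.
Qed.

End ExactTrajectory.

(** Sampled at the time nodes, the exact solution is a trajectory of the scheme
    with residuals of order one in the time step: on the compact set it never
    leaves, the right-hand sides are Lipschitz and the solution is Lipschitz in
    time. *)
Lemma consistency delta M : 0 < delta -> exists2 C : R, 0 <= C &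
  forall rho0 phi rho N, exact_solution G H B g T rho0 phi rho -> (0 < N)%N ->
  (forall t, t \in `[0, T] -> simplex_eps delta (rho t) /\
    `|gradG G (phi t)| <= M) ->
  exists a b : nat -> 'rV[R]_d,
    [/\ perturbed G H B g T delta M N a b (fun n => phi (n%:R * (T / N%:R)))
          (fun n => rho (n%:R * (T / N%:R))),
        forall n, (n < N)%N -> `|a n| <= C * (T / N%:R) &
        forall n, (n < N)%N -> `|b n| <= C * (T / N%:R)].
Proof.
move=> delta0.
have [LH LH0 lipH] := C1_lipschitz_box M delta0 (A_H_C1 hA).
have [LB LB0 lipB] := C1_lipschitz_box M delta0 (A_B_C1 hA).
have [MH MH0 HM] := lipschitz_box_bounded LH0 lipH.
have [MB MB0 BM] := lipschitz_box_bounded LB0 lipB.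
set w := opnorm_graph G; have w0 : 0 <= w := opnorm_graph_ge0 G.
pose D := MH + w * `|M| + w * MB + 2 * w ^+ 2.
have lap0 : 0 <= 2 * w ^+ 2 by rewrite mulr_ge0// sqr_ge0.
have wM0 : 0 <= w * `|M| by rewrite mulr_ge0.
have wB0 : 0 <= w * MB by rewrite mulr_ge0.
have D0 : 0 <= D by rewrite !addr_ge0.
exists (consistency_cst D LH LB); first exact: consistency_cst_ge0.
move=> rho0 phi rho N [dphi [drho [[phi_d _] [[rho_d _] [flow [start end_]]]]]]
  N0 box.
have box_t t : t \in `[0, T] -> phase_box G delta M (rho t, gradG G (phi t)).
  by move=> /box[rb gb]; split=> //; split=> //; exact: skewE_gradG.
have dphiE t : t \in `[0, T] ->
  dphi t = H (rho t) (gradG G (phi t)) - lapG G (phi t).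
  by move=> /flow[].
have drhoE t : t \in `[0, T] ->
    drho t = divG G (B (rho t) (gradG G (phi t))) + lapG G (rho t).
  by move=> /flow[].
have dphi_le t : t \in `[0, T] -> `|dphi t| <= D.
  move=> tT; rewrite dphiE//; apply: le_trans (ler_normB _ _) _.
  have h1 := HM _ (box_t t tT); have [_ gM] := box t tT.
  have h2 := le_trans (divG_le G _) (ler_wpM2l w0 (le_trans gM (ler_norm M))).
  by rewrite /D /lapG; simpl in h1; lra.
have drho_le t : t \in `[0, T] -> `|drho t| <= D.
  move=> tT; rewrite drhoE//; apply: le_trans (ler_normD _ _) _.
  have h1 := le_trans (divG_le G _) (ler_wpM2l w0 (BM _ (box_t t tT))).
  have [[rs _] _] := box t tT.
  have h2 := le_trans (lapG_le G _) (ler_wpM2l lap0 (simplex_norm rs)).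
  by rewrite /D; simpl in h1; rewrite mulr1 in h2; lra.
set tau := T / N%:R; have tau0 : 0 < tau by rewrite divr_gt0// ltr0n.
have node n : (n <= N)%N -> n%:R * tau \in `[0, T].
  move=> nN; rewrite in_itv/= mulr_ge0 ?(ltW tau0)//=.
  exact: natM_tau_le.
have nodeS n : n.+1%:R * tau = n%:R * tau + tau by rewrite -natr1 mulrDl mul1r.
pose phin n := phi (n%:R * tau); pose rhon n := rho (n%:R * tau).
pose a n := tau^-1 *: (phin n.+1 - phin n)
    - (H (rhon n.+1) (gradG G (phin n)) - lapG G (phin n)).
pose b n := tau^-1 *: (rhon n.+1 - rhon n)
    - (divG G (B (rhon n.+1) (gradG G (phin n))) + lapG G (rhon n.+1)).
have res n : (n < N)%N ->
    `|a n| <= consistency_cst D LH LB * tau /\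
      `|b n| <= consistency_cst D LH LB * tau.
  move=> nN; rewrite /a /b /phin /rhon nodeS.
  apply: (exact_step_residual D0 LH0 LB0 lipH lipB phi_d rho_d dphiE drhoE
    (fun t tT => (box t tT).1) (fun t tT => (box t tT).2) dphi_le drho_le) =>
      //.
    by have := node n (ltnW nN); rewrite in_itv/= => /andP[].
  by rewrite -nodeS; have := node n.+1 nN; rewrite in_itv/= => /andP[].
have tauK (x v : 'rV[R]_d) : x = tau *: (v + (tau^-1 *: x - v)).
  by rewrite addrC subrK scalerA mulfV ?scale1r// gt_eqF.
exists a, b; split; [|by move=> n /res[]|by move=> n /res[]].
split=> [n nN|n nN||n nN|n nN].
- exact: tauK.
- exact: tauK.
- by rewrite (_ : N%:R * tau = T)// mulrC divfK// pnatr_eq0 -lt0n.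
- by have [] := box _ (node n nN).
- by have [] := box _ (node n nN).
Qed.

End Consistency.

(** * Uniqueness, bounds and convergence *)

Section Assembly.
Variables (R : realType) (d : nat) (G : wgraph R d).

Lemma simplex_eps_le e e' (u : 'rV[R]_d) : e' <= e -> simplex_eps e u ->
  simplex_eps e' u.
Proof. by move=> ee [us ue]; split=> // i; exact: le_trans (ue i). Qed.

Variables (H : 'rV[R]_d -> 'M[R]_d -> 'rV[R]_d).
Variables (B : 'rV[R]_d -> 'M[R]_d -> 'M[R]_d).
Variables (g : 'rV[R]_d -> 'rV[R]_d).

Lemma scheme_perturbed T rho0 delta M N phi rho :
  0 < T -> (0 < N)%N -> interior_solution G H B g T rho0 N phi rho ->
  (forall n, (n <= N)%N -> simplex_eps delta (rho n)) ->
  (forall n, (n <= N)%N -> `|gradG G (phi n)| <= M) ->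
  perturbed G H B g T delta M N (fun=> 0) (fun=> 0) phi rho.
Proof.
move=> hT N0 sol rd gM; split=> // [n nN|n nN|].
- by rewrite addr0; exact: scheme_phi_step sol _ nN.
- by rewrite addr0; exact: scheme_rho_step sol _ nN.
- exact: scheme_phiN sol.
Qed.

End Assembly.

Theorem theorem3p1 (R : realType) (d : nat) (G : wgraph R d)
    (H : 'rV[R]_d -> 'M[R]_d -> 'rV[R]_d)
    (B : 'rV[R]_d -> 'M[R]_d -> 'M[R]_d)
    (g : 'rV[R]_d -> 'rV[R]_d) (T eps : R)
    (hd : (2 <= d)%N) (hT : 0 < T) (heps : 0 < eps < d%:R^-1)
    (hA : assumptionA G H B g) (hB : assumptionB G H B g) :
  (forall (rho0 : 'rV[R]_d) (N : nat), simplex_eps eps rho0 -> (0 < N)%N ->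
    forall phi rho phi' rho' : nat -> 'rV[R]_d,
      interior_solution G H B g T rho0 N phi rho ->
      interior_solution G H B g T rho0 N phi' rho' ->
      forall n, (n <= N)%N -> phi n = phi' n /\ rho n = rho' n)
  /\
  (exists deltaT CT : R, 0 < deltaT /\ 0 < CT /\
    forall (rho0 : 'rV[R]_d) (N : nat), simplex_eps eps rho0 -> (0 < N)%N ->
    forall phi rho : nat -> 'rV[R]_d,
      interior_solution G H B g T rho0 N phi rho ->
      (forall n (i : 'I_d), (n <= N)%N -> deltaT <= rho n 0 i) /\
      \big[Num.max/0]_(n < N.+1)
        (norm_sup (phi n) + normE_sup G (gradG G (phi n))) <= CT)
  /\
  (exists tau0 CT : R, 0 < tau0 /\ 0 < CT /\
    forall (rho0 : 'rV[R]_d) (N : nat), simplex_eps eps rho0 -> (0 < N)%N ->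
    let tau := T / N%:R in
    tau <= tau0 ->
    forall phi rho : nat -> 'rV[R]_d,
      interior_solution G H B g T rho0 N phi rho ->
    forall phi_ex rho_ex : R -> 'rV[R]_d,
      exact_solution G H B g T rho0 phi_ex rho_ex ->
      \big[Num.max/0]_(n < N.+1)
        (norm2 (rho_ex (n%:R * tau) - rho n)
         + norm2 (phi_ex (n%:R * tau) - phi n))
      + Num.sqrt (tau * \sum_(n < N)
          normE G (gradG G (phi_ex (n%:R * tau)) - gradG G (phi n)) ^+ 2)
      <= CT * tau).
Proof.
have [eps0 _] := andP heps.
have [delta1 [M1 [delta10 [M10 bound]]]] := scheme_a_priori hA hT eps0.
have [delta2 [M2 [delta20 [M20 exbound]]]] := exact_a_priori hA hT eps0.
split; [|split].
- move=> rho0 N hrho0 N0 phi rho phi' rho' sol sol' n nN.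
  have [C _ stab] := stability hA hB hT M1 delta10.
  have bd := bound _ _ hrho0 N0 _ _ sol;
    have bd' := bound _ _ hrho0 N0 _ _ sol'.
  have pert : perturbed G H B g T delta1 M1 N (fun=> 0) (fun=> 0) phi rho.
    by apply: (scheme_perturbed hT N0 sol) => k /bd[].
  have pert' : perturbed G H B g T delta1 M1 N (fun=> 0) (fun=> 0) phi' rho'.
    by apply: (scheme_perturbed hT N0 sol') => k /bd'[].
  have start : rho 0%N = rho' 0%N.
    by rewrite (scheme_rho0 sol) (scheme_rho0 sol').
  have z0 k : (k < N)%N -> `|0 : 'rV[R]_d| <= (0 : R) by rewrite normr0.
  have [/(_ n nN)[]] := stab N 0 _ _ _ _ _ _ N0 (lexx 0) pert pert' start z0 z0.
  by rewrite mulr0 !normr_le0 !subr_eq0 => /eqP -> /eqP ->.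
- exists delta1, (2 * M1 + 1); split=> //; split;
  first by rewrite ltr_wpDl// mulr_ge0.
  move=> rho0 N hrho0 N0 phi rho sol; have bd := bound _ _ hrho0 N0 _ _ sol.
  split=> [n i /bd[[_ rd] _ _]|]; first exact: rd.
  apply/bigmax_leP; split=> [|n _]; first by rewrite addr_ge0// mulr_ge0.
  have [_ pM gM] := bd n (ltn_ord n).
  have := norm_sup_le (phi n); have := normE_sup_le G (gradG G (phi n)); lra.
pose delta := Num.min delta1 delta2; pose M := Num.max M1 M2.
have delta0 : 0 < delta by rewrite lt_min delta10.
have [C C0 stab] := stability hA hB hT M delta0.
have [Cc Cc0 cons] := consistency hA hT M delta0.
have CC0 : 0 <= 3 * d%:R * C * Cc by rewrite !mulr_ge0.
(* [2 * d] for the two pointwise Euclidean norms, [d] for the l2 term; the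
   summand 1 makes the constant positive. *)
exists 1, (3 * d%:R * C * Cc + 1); split=> //; split; first by rewrite ltr_wpDl.
move=> rho0 N hrho0 N0 tau _ phi rho sol phi_ex rho_ex ex.
have tau0 : 0 < tau by rewrite divr_gt0// ltr0n.
have bd := bound _ _ hrho0 N0 _ _ sol; have exbd := exbound _ hrho0 _ _ ex.
have pert : perturbed G H B g T delta M N (fun=> 0) (fun=> 0) phi rho.
  apply: (scheme_perturbed hT N0 sol) => k /bd[rd _ gM].
    by apply: simplex_eps_le rd; rewrite ge_min lexx.
  by rewrite le_max gM.
have [|a [b [pert_ex ak bk]]] := cons _ _ _ N ex N0.
  move=> t /exbd[rd _ gM]; split; last by rewrite le_max gM orbT.
  by apply: simplex_eps_le rd; rewrite ge_min lexx orbT.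
have kappa0 : 0 <= Cc * tau by rewrite mulr_ge0// ltW.
have start : rho_ex (0%:R * tau) = rho 0%N.
  have [? [? [_ [_ [_ [rs _]]]]]] := ex.
  by rewrite mul0r rs (scheme_rho0 sol).
have [pointwise energy] :=
  stab N (Cc * tau) a b _ _ phi rho N0 kappa0 pert_ex pert start ak bk.
have CK0 : 0 <= C * (Cc * tau) by rewrite mulr_ge0.
have ptw : \big[Num.max/0]_(n < N.+1)
    (norm2 (rho_ex (n%:R * tau) - rho n) + norm2 (phi_ex (n%:R * tau) - phi n))
    <= 2 * d%:R * (C * (Cc * tau)).
  apply/bigmax_leP; split=> [|n _]; first by apply: mulr_ge0 CK0;
    rewrite mulr_ge0.
  have [rb pb] := pointwise n (ltn_ord n).
  have := le_trans (norm2_le _) (ler_wpM2l (ler0n R d) rb).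
  have := le_trans (norm2_le _) (ler_wpM2l (ler0n R d) pb).
  lra.
have l2 : Num.sqrt (tau * \sum_(n < N)
    normE G (gradG G (phi_ex (n%:R * tau)) - gradG G (phi n)) ^+ 2)
    <= d%:R * (C * (Cc * tau)).
  have X0 : 0 <= d%:R * (C * (Cc * tau)) by rewrite mulr_ge0.
  rewrite -(ger0_norm X0) -sqrtr_sqr ler_sqrt ?sqr_ge0// exprMn.
  apply: le_trans (ler_wpM2l (sqr_ge0 d%:R) energy).
  rewrite mulrCA ler_pM2l// mulr_sumr; apply: ler_sum => n _.
  rewrite -exprMn; apply: lerXn2r; rewrite ?nnegrE ?sqrtr_ge0 ?mulr_ge0//.
  exact: normE_le.
by lra.
Qed.
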